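(* Assume that $y_1\notin\mathbb Zv$. If $y_2\in\mathbb Zv$, then we have $$\lim_{\varepsilon\to0^+}f_3(z_1,z_2+i\varepsilon;\tau)=q^{-\frac{3y_2}{2v}\left(\frac{y_2}{v}+1\right)}\zeta_1^{-\frac32}\zeta_2^{\frac{3y_2}{v}+\frac32}\,\vartheta\left(3z_1-\tfrac{3\tau}2+\tfrac12;3\tau\right)\mu\left(3z_2-\tfrac{3y_2}{v}\tau+\tfrac12,\tfrac{3\tau}2;3\tau\right)$$ $$\qquad-\,i\left(\zeta_1^{-1}\zeta_2\right)^{\frac32}\frac{\eta^3(3\tau)\,\vartheta\left(3(z_1-z_2)-\frac{3\tau}2;3\tau\right)\vartheta\left(3z_1+\frac12;3\tau\right)}{\vartheta(3(z_1-z_2);3\tau)\,\vartheta\left(3z_2+\frac12;3\tau\right)\vartheta\left(\frac{3\tau}2;3\tau\right)}.$$ In particular, for $z_2=\ell\tau+m$ with $\ell,m\in\mathbb Z$ we have $$\lim_{\varepsilon\to0^+}f_3(z_1,\ell\tau+m+i\varepsilon;\tau)=-\tfrac12q^{\frac{3\ell^2}2+\frac38}\zeta_1^{-\frac32}\,\vartheta\left(3z_1-\tfrac{3\tau}2+\tfrac12;3\tau\right)$$ $$\qquad-\,\tfrac12q^{\frac{3\ell^2}2+\frac34}\zeta_1^{-\frac32}\,\frac{\vartheta\left(\frac{3\tau}2-\frac12;3\tau\right)\vartheta\left(3z_1-\frac{3\tau}2;3\tau\right)\vartheta\left(3z_1+\frac12;3\tau\right)}{\vartheta(3z_1;3\t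au)}.$$
   Context: Notation: $\tau=u+iv\in\mathbb H$ (upper half-plane) is fixed, $z_j=x_j+iy_j\in\mathbb C$, $q:=e^{2\pi i\tau}$, $\zeta_j:=e^{2\pi i z_j}$, with powers $q^s:=e^{2\pi i s\tau}$, $\zeta_j^s:=e^{2\pi i sz_j}$, $(\zeta_1^{-1}\zeta_2)^s:=e^{2\pi i s(z_2-z_1)}$. $\operatorname{sgn}(x):=|x|/x$ for $x\neq0$, $\operatorname{sgn}(0):=0$; $H(x):=1$ for $x>0$, $H(x):=0$ for $x\le0$; $H^*(x):=1$ for $x\ge0$, $H^*(x):=0$ for $x<0$. With $\chi_3(\boldsymbol x):=\operatorname{sgn}(x_1)H(|x_1|-|x_2|)H^*(x_1x_2)$, for $\boldsymbol z=\boldsymbol x+i\boldsymbol y\in\mathbb C^2$, $$f_3(\boldsymbol z;\tau):=\sum_{\boldsymbol n\in\mathbb Z^2}\chi_3\left(\boldsymbol n+\tfrac{\boldsymbol y}{v}\right)q^{\frac32(n_1^2-n_2^2)}\zeta_1^{3n_1}\zeta_2^{-3n_2}.$$ Moreover $\eta(\tau):=q^{1/24}\prod_{n\ge1}(1-q^n)$, $\vartheta(z;\tau):=\sum_{n\in\frac12+\mathbb Z}q^{n^2/2}e^{2\pi i n(z+\frac12)}$, and $$A(z_1,z_2;\tau):=e^{\pi i z_1}\sum_{n\in\mathbb Z}\frac{(-1)^nq^{\frac{n(n+1)}{2}}e^{2\pi i nz_2}}{1-e^{2\pi i z_1}q^n},\qquad \mu(z_1,z_2;\tau):=\frac{A(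z_1,z_2;\tau)}{\vartheta(z_2;\tau)}.$$
   Formalization: The second summand is proved with sign +i (general formula) and +1/2 (special case) instead of the printed -i and -1/2, which are false; where 3z_2+1/2 lies in 3τZ+Z and the right side is undefined, its continuous extension along Im z_2 constant is used. *)

(* Defs.v *)
From HB Require Import structures.
From mathcomp Require Import all_boot all_order all_algebra.
From mathcomp Require Import all_classical all_reals all_analysis.
From mathcomp Require Import complex.
From mathcomp.analysis.showcase Require Import summability.
Set Implicit Arguments.
Unset Strict Implicit.
Unset Printing Implicit Defensive.
Import Order.TTheory GRing.Theory Num.Theory.
Import numFieldNormedType.Exports.
Local Open Scope classical_set_scope.
Local Open Scope ring_scope.
Local Open Scope complex_scope.

(* Complex numbers, as a numFieldType so that they carry the topology induced
   by the modulus. *)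
Notation CC R := (R[i] : numFieldType).

Definition cexp {R : realType} (z : CC R) : CC R :=
  (expR (complex.Re z))%:C * (cos (complex.Im z) +i* sin (complex.Im z)).

(* w^s for w = exp(2 pi i z): for real s, q^s is epow tau s and zeta_j^s is
   epow z_j s. *)
Definition epow {R : realType} (z : CC R) (s : R) : CC R :=
  cexp (2 * pi%:C * 'i%C * s%:C * z).

(* Unordered sum: summability.sum is the limit of the finite partial sums along
   the directed set of finite subsets of the index type. *)
Definition usum {R : realType} {I : choiceType} (F : I -> CC R) : CC R :=
  summability.sum F.

Definition theta {R : realType} (z tau : CC R) : CC R :=
  usum (fun n : int =>
    epow tau ((n%:~R + 1 / 2) ^+ 2 / 2) * epow (z + 1 / 2) (n%:~R + 1 / 2)).

Definition eta {R : realType} (tau : CC R) : CC R :=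
  epow tau (1 / 24) *
  lim ((fun N : nat => \prod_(1 <= n < N.+1) (1 - epow tau n%:R)) @ \oo).

Definition appellA {R : realType} (z1 z2 tau : CC R) : CC R :=
  epow z1 (1 / 2) *
  usum (fun n : int =>
    (-1) ^ n * epow tau ((n * (n + 1))%:~R / 2) * epow z2 n%:~R
    / (1 - epow z1 1 * epow tau n%:~R)).

Definition mu {R : realType} (z1 z2 tau : CC R) : CC R :=
  appellA z1 z2 tau / theta z2 tau.

Definition heaviside {R : realType} (x : R) : R := (0 < x)%R%:R.
Definition heaviside_star {R : realType} (x : R) : R := (0 <= x)%R%:R.

Definition chi3 {R : realType} (x1 x2 : R) : R :=
  Num.sg x1 * heaviside (`|x1| - `|x2|) * heaviside_star (x1 * x2).

Definition f3 {R : realType} (z1 z2 tau : CC R) : CC R :=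
  usum (fun n : int * int =>
    (chi3 (n.1%:~R + complex.Im z1 / complex.Im tau) (n.2%:~R + complex.Im z2 / complex.Im tau))%:C
    * epow tau (3 / 2 * (n.1%:~R ^+ 2 - n.2%:~R ^+ 2))
    * epow z1 (3 * n.1%:~R) * epow z2 (- 3 * n.2%:~R)).

(* z lies in Z tau + Z, the zero set of theta. *)
Definition in_lattice {R : realType} (z tau : CC R) : Prop :=
  exists a b : int, z = a%:~R * tau + b%:~R.

(* The closed form of the limit of f3 for Im z2 in Z Im tau. Both summands have
   a pole when 3 z2 + 1/2 lies in the lattice of 3 tau, and these poles cancel.
   With the above theta one has theta'(0; tau) = - 2 pi eta(tau)^3, so that the
   second summand carries the sign + (the source prints -). *)
Definition f3_boundary {R : realType} (z1 z2 tau : CC R) : CC R :=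
  let y := complex.Im z2 / complex.Im tau in
  epow tau (- (3 * y / 2) * (y + 1)) * epow z1 (- (3 / 2))
    * epow z2 (3 * y + 3 / 2)
    * theta (3 * z1 - 3 * tau / 2 + 1 / 2) (3 * tau)
    * mu (3 * z2 - (3 * y)%:C * tau + 1 / 2) (3 * tau / 2) (3 * tau)
  + 'i%C * epow (z2 - z1) (3 / 2)
    * (eta (3 * tau) ^+ 3
       * theta (3 * (z1 - z2) - 3 * tau / 2) (3 * tau)
       * theta (3 * z1 + 1 / 2) (3 * tau)
       / (theta (3 * (z1 - z2)) (3 * tau)
          * theta (3 * z2 + 1 / 2) (3 * tau)
          * theta (3 * tau / 2) (3 * tau))).

(* The same closed form at z2 = l tau + m. *)
Definition f3_lattice {R : realType} (z1 : CC R) (l : int) (tau : CC R) : CC R :=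
  - (1 / 2) * epow tau (3 * l%:~R ^+ 2 / 2 + 3 / 8) * epow z1 (- (3 / 2))
    * theta (3 * z1 - 3 * tau / 2 + 1 / 2) (3 * tau)
  + 1 / 2 * epow tau (3 * l%:~R ^+ 2 / 2 + 3 / 4) * epow z1 (- (3 / 2))
    * (theta (3 * tau / 2 - 1 / 2) (3 * tau)
       * theta (3 * z1 - 3 * tau / 2) (3 * tau)
       * theta (3 * z1 + 1 / 2) (3 * tau)
       / theta (3 * z1) (3 * tau)).

(* Main.v *)
From Pilot Require Import Defs.
From HB Require Import structures.
From mathcomp Require Import all_boot all_order all_algebra.
From mathcomp Require Import all_classical all_reals all_analysis.
From mathcomp Require Import complex finmap ring lra zify.
From mathcomp.analysis.showcase Require Import summability.
Set Implicit Arguments.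
Unset Strict Implicit.
Unset Printing Implicit Defensive.
Import Order.TTheory GRing.Theory Num.Theory.
Import numFieldNormedType.Exports.
Local Open Scope classical_set_scope.
Local Open Scope ring_scope.
Local Open Scope complex_scope.
#[local] Existing Instance totally_filter.

(* With [T = 3 tau], [w_j = 3 z_j], [y_1 = (k + a) v] with [0 < a < 1] and [y_2 = l v], the
   substitution [n_1 = r + M - k], [n_2 = M - l] turns the terms of [f3] at [z_2 + i eps], for small
   [eps > 0], into a sum over [r, M >= 0] minus a sum over [r, M < 0]. On this cone the terms decay
   geometrically, uniformly in small shifts of [z_2], so dominated convergence identifies the limit
   with the cone sum at [eps = 0] and shows that this sum is continuous under real shifts of [z_2];
   the latter settles the case in which the two summands of the closed form have cancelling poles.

   The sums over [M] are geometric, so the cone sum is an Appell sum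
   [sum_k (-z)^k q^(k(k+1)/2) / (1 - q^k x z)]. Two such sums with the same [x], at [z_0] and [z_1],
   are related by the partial fraction expansion in [x] of
   [theta(x z_0 z_1) / (theta(x z_0) theta(x z_1))]. Truncating the theta products makes this a
   Lagrange interpolation identity between rational functions, and dominated convergence lets the
   truncation tend to infinity. The product expansion of theta comes in the same way from the finite
   q-binomial theorem. At the lattice points the remaining Appell sum is evaluated by [n -> -n] and
   the triple product, and Euler's identity [(-q; q) (p; q) (-p; q) = 1], [q = p^2], gives the stated
   form. *)

(** * Unordered sums *)

(** Convergence is the obstacle: the exponent is governed by the indefinite form [n_1^2 - n_2^2]. On
    the cone it becomes [(r + a)(r + 2 M + a)] up to constants, and this dominates [|r| + |M|]
    because [y_1] not in [Z v] keeps [a] away from both 0 and 1. The one-sided limit matters because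
    [chi3] jumps at [y_2 = l v]: a small positive shift drops the terms with [M = 0], [r < 0], which
    count with sign -1 on the boundary itself.

    No complex analysis enters. Poles and residues occur only in identities between rational
    functions, and every limit is a dominated convergence. Hence the theta identities are proved
    over any field in which absolutely bounded families are summable, for any [e] that turns sums
    into products, has kernel [Z] and satisfies [e (1 / 2) = -1].

    The two Appell sums to compare are the cone sum, with denominators [1 - q^n e(w_1 - w_2)], and
    the one in [mu], with denominators [1 - q^n e(w_2 + 1/2)]. As [w_2] enters with opposite signs,
    they share a common [x] only after the second is reversed by [n -> -n]; then
    [x = e(-w_2 + T/2 - 1/2)], [z_0 = e(-T/2)] and [z_1 = e(w_1 - T/2 + 1/2)]. *)

Definition psum {I : choiceType} {K : numFieldType} (F : I -> K) (A : {fset I}) : K :=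
  \sum_(i <- A) F i.

Definition hassum {I : choiceType} {K : numFieldType} (F : I -> K) (S : K) : Prop :=
  psum F @ totally --> S.

Definition bounded_psum {I : choiceType} {K : numFieldType} (g : I -> K) : Prop :=
  exists M, forall A : {fset I}, psum g A <= M.

Section Sums.
Context {K : numFieldType} {I : choiceType}.
Implicit Types (F G g : I -> K) (S T : K).

Lemma hassumP F S : hassum F S <-> forall e : K, 0 < e -> exists A : {fset I},
  forall B : {fset I}, fsubset A B -> `|S - psum F B| < e.
Proof.
split.
  move=> /cvgrPdist_lt H e e0; have [A _ HA] := H e e0.
  by exists A => B AB; exact: (HA B).
move=> H; apply/cvgrPdist_lt => e e0; have [A HA] := H e e0.
by exists A => // B /= AB; exact: HA.
Qed.

Lemma partial_sumE F : partial_sum F = psum F.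
Proof.
by apply/funext => A; rewrite /partial_sum /psum [RHS]big_seq_fsetE.
Qed.

Lemma hassum_unique F S T : hassum F S -> hassum F T -> S = T.
Proof. by move=> h1 h2; exact: (cvg_unique _ h1 h2). Qed.

Lemma hassum_ext F G S : hassum F S -> F =1 G -> hassum G S.
Proof. by move=> h /funext <-. Qed.

Lemma hassumD F G S T : hassum F S -> hassum G T ->
  hassum (fun i => F i + G i) (S + T).
Proof.
move=> hF hG; rewrite /hassum.
have -> : psum (fun i => F i + G i) = (fun A => psum F A + psum G A).
  by apply/funext => A; rewrite /psum big_split.
exact: cvgD.
Qed.

Lemma hassumZ c F S : hassum F S -> hassum (fun i => c * F i) (c * S).
Proof.
move=> hF; rewrite /hassum.
have -> : psum (fun i => c * F i) = (fun A => c * psum F A).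
  by apply/funext => A; rewrite /psum mulr_sumr.
by apply: cvgM => //; exact: cvg_cst.
Qed.

Lemma psumU F (A B : {fset I}) : [disjoint A & B]%fset ->
  psum F (A `|` B)%fset = psum F A + psum F B.
Proof.
move=> AB; rewrite /psum (big_fsetID _ (mem A)) /=; congr (_ + _).
  by apply: eq_fbigl => i; rewrite !inE /= andb_orl andbb andbC; case: (i \in A).
apply: eq_fbigl => i; rewrite !inE /=.
by case: (boolP (i \in A)) => [iA|]; rewrite ?andbT //= (negbTE (fdisjointP AB _ iA)).
Qed.

Lemma psum_sub F (A B : {fset I}) : fsubset A B -> psum F B = psum F A + psum F (B `\` A)%fset.
Proof.
move=> AB; rewrite -psumU; last by apply/fdisjointP => i iA; rewrite !inE iA.
by rewrite fsetUDl fsetDv fsetD0; congr psum; apply/esym/fsetUidPr.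
Qed.

Lemma hassum_fset F (A : {fset I}) : (forall i, i \notin A -> F i = 0) ->
  hassum F (psum F A).
Proof.
move=> F0; apply/hassumP => e e0; exists A => B AB.
rewrite (psum_sub _ AB) [psum F (B `\` A)%fset]big1_seq ?addr0 ?subrr ?normr0 //.
by move=> i /andP[_]; rewrite !inE => /andP[/F0].
Qed.

Lemma cvg_psum {T : Type} (FF : set_system T) {PF : Filter FF} (F' : T -> I -> K) G (A : {fset I}) :
  (forall i, F' ^~ i @ FF --> G i) -> (fun t => psum (F' t) A) @ FF --> psum G A.
Proof.
move=> FG; rewrite /psum; elim: (A : seq I) => [|i r IH].
  by rewrite big_nil; under eq_fun do rewrite big_nil; exact: cvg_cst.
by rewrite big_cons; under eq_fun do rewrite big_cons; exact: cvgD.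
Qed.

Lemma psum_tail F g (A B : {fset I}) e :
  (forall i, `|F i| <= g i) -> fsubset A B ->
  (forall D : {fset I}, [disjoint A & D]%fset -> psum g D <= e) ->
  `|psum F B - psum F A| <= e.
Proof.
move=> Fg AB He.
rewrite (psum_sub _ AB) addrC addKr.
apply: (@le_trans _ _ (psum g (B `\` A)%fset)); last first.
  by apply: He; apply/fdisjointP => i iA; rewrite !inE iA.
rewrite /psum; apply: le_trans (ler_norm_sum _ _ _) _.
by apply: ler_sum => i _; exact: Fg.
Qed.

Lemma hassum_tail F g S (A : {fset I}) e :
  hassum F S -> (forall i, `|F i| <= g i) ->
  (forall D : {fset I}, [disjoint A & D]%fset -> psum g D <= e) ->
  `|S - psum F A| <= e.
Proof.
move=> /hassumP hF Fg He.
apply/ler_addgt0Pr => d d0; have [B HB] := hF d d0.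
have /HB h1 : fsubset B (A `|` B)%fset by exact: fsubsetUr.
have h2 := psum_tail Fg (fsubsetUl A B) He.
rewrite -[X in `|X|](subrKA (psum F (A `|` B)%fset)) addrC [e + d]addrC.
rewrite addrC; apply: le_trans (ler_normD _ _) _; apply: lerD => //.
exact: ltW.
Qed.

End Sums.

Lemma hassum_usum {R : realType} {I : choiceType} (F : I -> CC R) S :
  hassum F S -> usum F = S.
Proof.
move=> hF; rewrite /usum /summability.sum partial_sumE.
by apply: cvg_lim => //.
Qed.

Lemma hassum_reindex {K : numFieldType} {I J : choiceType} (h : I -> J) (h' : J -> I)
    (F : J -> K) S :
  cancel h h' -> cancel h' h -> hassum F S -> hassum (F \o h) S.
Proof.
move=> hK h'K /hassumP hF; apply/hassumP => e e0; have [A HA] := hF e e0.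
exists (h' @` A)%fset => B AB.
have -> : psum (F \o h) B = psum F (h @` B)%fset.
  rewrite /psum big_imfset //=; move=> x y _ _; exact: (can_inj hK).
apply: HA; apply/fsubsetP => j jA.
apply/imfsetP; exists (h' j); last by rewrite h'K.
by move/fsubsetP: AB; apply; apply/imfsetP; exists j.
Qed.

Lemma hassum_sum {K : numFieldType} {I J : choiceType} (F : I -> J -> K) (s : I -> K)
    (B : {fset I}) :
  (forall i, hassum (F i) (s i)) ->
  hassum (fun j => \sum_(i <- B) F i j) (\sum_(i <- B) s i).
Proof.
move=> H; elim: (B : seq I) => [|i r IH].
  rewrite big_nil; under eq_fun do rewrite big_nil.
  have := @hassum_fset K J (fun=> 0) fset0; rewrite /psum big_nil; exact.
rewrite big_cons; under eq_fun do rewrite big_cons.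
exact: hassumD.
Qed.

(** Absolute summability, made a property of the field so that the later identities can be proved
    over an abstract [K]. Over [R[i]] the order relates only numbers with equal imaginary part, so
    [|F i| <= g i] makes [g] real and nonnegative. *)
Definition sumcomplete (K : numFieldType) := forall (I : choiceType) (F g : I -> K),
  bounded_psum g -> (forall i, `|F i| <= g i) -> exists S, hassum F S.

Arguments hassumZ {K I} c {F S}.

(** * Tails, dominated convergence and Fubini *)

Section Complete.
Context {K : numFieldType} (Kc : sumcomplete K).

Lemma bounded_psum_tail {I : choiceType} (g : I -> K) : bounded_psum g -> (forall i, 0 <= g i) ->
  forall e : K, 0 < e -> exists A : {fset I},
    forall D : {fset I}, [disjoint A & D]%fset -> psum g D <= e.
Proof.
move=> gb g0 e e0.
have [|S /hassumP/(_ (e / 2))] := Kc gb (F := g).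
  by move=> i; rewrite ger0_norm.
rewrite divr_gt0 // => /(_ isT)[A HA]; exists A => D AD.
have h1 := HA _ (fsubset_refl A); have h2 := HA _ (fsubsetUl A D).
have E : psum g (A `|` D)%fset = psum g A + psum g D.
  exact: psumU.
have -> : psum g D = (S - psum g A) - (S - psum g (A `|` D)%fset).
  by rewrite E; ring.
have p0 : 0 <= S - psum g A - (S - psum g (A `|` D)%fset).
  have -> : S - psum g A - (S - psum g (A `|` D)%fset) = psum g D.
    by rewrite E; ring.
  by apply: sumr_ge0.
rewrite -(ger0_norm p0); apply: le_trans (ler_normB _ _) _.
by rewrite (splitr e); apply: lerD; apply: ltW.
Qed.

(** The finite set [A] comes from the majorant [g] alone, so it controls the tails of all the
    families [F t] and of [G] at once; on [A] the limit is that of a finite sum. The filter is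
    arbitrary because the lemma serves [N -> oo], [eps -> 0+] and punctured real shifts alike. *)
Lemma hassum_dominated {T : Type} (FF : set_system T) {PF : Filter FF} {I : choiceType}
    (F : T -> I -> K) (G g : I -> K) (S : T -> K) (SG : K) :
  bounded_psum g -> (forall i, `|G i| <= g i) ->
  (\forall t \near FF, forall i, `|F t i| <= g i) ->
  (forall i, F ^~ i @ FF --> G i) ->
  (\forall t \near FF, hassum (F t) (S t)) -> hassum G SG -> S @ FF --> SG.
Proof.
move=> gb Gg Fg FG FS GS; apply/cvgrPdist_le => e e0.
have e3 : 0 < e / 3 by rewrite divr_gt0.
have g0 i : 0 <= g i := le_trans (normr_ge0 _) (Gg i).
have [A HA] := bounded_psum_tail gb g0 e3.
have /cvgrPdist_lt/(_ _ e3) FGA : (fun t => psum (F t) A) @ FF --> psum G A.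
  exact: cvg_psum.
near=> t.
have h1 : `|SG - psum G A| <= e / 3 by apply: hassum_tail GS Gg HA.
have h2 : `|S t - psum (F t) A| <= e / 3.
  by apply: (@hassum_tail _ _ _ g) HA; [near: t|near: t].
have h3 : `|psum G A - psum (F t) A| <= e / 3 by apply: ltW; near: t.
have -> : SG - S t = (SG - psum G A) + (psum G A - psum (F t) A) - (S t - psum (F t) A).
  by ring.
have -> : e = e / 3 + e / 3 + e / 3 by field.
apply: le_trans (ler_normB _ _) _; apply: lerD => //.
by apply: le_trans (ler_normD _ _) _; apply: lerD.
Unshelve. all: by end_near. Qed.

Lemma hassum_fubini {I J : choiceType} (F g : I * J -> K) (s : I -> K) S :
  bounded_psum g -> (forall i, `|F i| <= g i) ->
  (forall i, hassum (fun j => F (i, j)) (s i)) -> hassum F S -> hassum s S.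
Proof.
move=> gb Fg Fs FS; apply/hassumP => e e0.
have e3 : 0 < e / 3 by rewrite divr_gt0.
have g0 i : 0 <= g i := le_trans (normr_ge0 _) (Fg i).
have [A HA] := bounded_psum_tail gb g0 e3.
(* Once [B] contains the first projection of [A], enlarging the second factor to [D'] makes the
   rectangle [B x D'] contain [A] while each row sum stays well approximated. *)
exists [fset i.1 | i in A]%fset => B AB.
have /hassumP/(_ _ e3)[D HD] := @hassum_sum _ _ _ (fun i j => F (i, j)) s B Fs.
pose D' := (D `|` [fset i.2 | i in A])%fset.
have h1 := HD _ (fsubsetUl D [fset i.2 | i in A]%fset).
pose P := [fset ((i, j) : I * J) | i in B, j in D']%fset.
have AP : fsubset A P.
  apply/fsubsetP => -[i j] ijA; apply/imfset2P.
  exists i; first by move/fsubsetP: AB; apply; apply/imfsetP; exists (i, j).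
  by exists j => //; rewrite !inE; apply/orP; right; apply/imfsetP; exists (i, j).
have h2 := hassum_tail FS Fg HA.
have h3 := psum_tail Fg AP HA.
have E : psum F P = psum (fun j => \sum_(i <- B) F (i, j)) D'.
  rewrite /psum /P exchange_big /= big_imfset2 //=.
  by move=> [? ?] [? ?] _ _ /= [-> ->].
rewrite -/D' -E in h1.
have -> : S - psum s B = (S - psum F A) - (psum F P - psum F A) - (psum s B - psum F P).
  by ring.
have -> : e = e / 3 + e / 3 + e / 3 by field.
apply: le_lt_trans (ler_normB _ _) _; apply: ler_ltD => //.
by apply: le_trans (ler_normB _ _) _; apply: lerD.
Qed.

End Complete.

(** * Families with bounded partial sums *)

Section AbsB.
Context {K : numFieldType}.

Lemma bounded_psum_le {I : choiceType} (g h : I -> K) :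
  (forall i, g i <= h i) -> bounded_psum h -> bounded_psum g.
Proof.
move=> gh [M hM]; exists M => A; apply: le_trans (hM A); exact: ler_sum.
Qed.

Lemma bounded_psumZ {I : choiceType} (c : K) (g : I -> K) :
  0 <= c -> bounded_psum g -> bounded_psum (fun i => c * g i).
Proof.
move=> c0 [M hM]; exists (c * M) => A; rewrite /psum -mulr_sumr.
by apply: ler_wpM2l => //; exact: hM.
Qed.

Lemma bounded_psumD {I : choiceType} (g h : I -> K) :
  bounded_psum g -> bounded_psum h -> bounded_psum (fun i => g i + h i).
Proof.
move=> [M hM] [N hN]; exists (M + N) => A; rewrite /psum big_split /=.
apply: lerD; [exact: hM|exact: hN].
Qed.

Lemma bounded_psum_prod {I J : choiceType} (g : I -> K) (h : J -> K) :
  (forall i, 0 <= g i) -> (forall j, 0 <= h j) -> bounded_psum g -> bounded_psum h ->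
  bounded_psum (fun i : I * J => g i.1 * h i.2).
Proof.
move=> g0 h0 [M hM] [N hN]; exists (M * N) => A.
pose A1 := [fset i.1 | i in A]%fset; pose A2 := [fset i.2 | i in A]%fset.
pose P := [fset ((i, j) : I * J) | i in A1, j in A2]%fset.
have AP : fsubset A P.
  apply/fsubsetP => -[i j] ijA; apply/imfset2P.
  exists i; first by apply/imfsetP; exists (i, j).
  by exists j => //; apply/imfsetP; exists (i, j).
apply: (@le_trans _ _ (psum (fun i : I * J => g i.1 * h i.2) P)).
  rewrite (psum_sub _ AP) lerDl; apply: sumr_ge0 => i _.
  exact: mulr_ge0.
rewrite /psum big_imfset2 /=; last by move=> [? ?] [? ?] _ _ /= [-> ->].
under eq_bigr do rewrite -mulr_sumr.
rewrite -mulr_suml; apply: ler_pM; try by apply: sumr_ge0.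
  exact: hM.
exact: hN.
Qed.

Lemma bounded_psum_int (g : int -> K) : bounded_psum (fun n : nat => g n%:Z) ->
  bounded_psum (fun n : nat => g (- n.+1%:Z)) -> bounded_psum g.
Proof.
move=> [M hM] [N hN]; exists (M + N) => A.
pose A1 := [fset n in A | 0 <= n]%fset; pose A2 := [fset n in A | ~~ (0 <= n)]%fset.
pose B1 := [fset absz n | n in A1]%fset; pose B2 := [fset (absz n).-1 | n in A2]%fset.
have -> : psum g A = psum (fun n : nat => g n%:Z) B1 + psum (fun n : nat => g (- n.+1%:Z)) B2.
  have pos x : x \in A1 -> 0 <= x by rewrite !inE => /andP[].
  have neg x : x \in A2 -> ~~ (0 <= x) by rewrite !inE => /andP[].
  have absI : {in A1 &, injective absz} by move=> x y /pos x0 /pos y0; lia.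
  have abspI : {in A2 &, injective (fun n => (absz n).-1)}.
    by move=> x y /neg x0 /neg y0; lia.
  rewrite /psum (big_fsetID _ (fun n : int => 0 <= n) A) !big_imfset //=; congr (_ + _).
    by rewrite !big_filter; apply: eq_bigr => i i0; congr g; lia.
  by rewrite !big_filter; apply: eq_bigr => i i0; congr g; lia.
exact: lerD.
Qed.

Lemma bounded_psum_geo (r : K) : 0 <= r -> r < 1 -> bounded_psum (fun n : nat => r ^+ n).
Proof.
move=> r0 r1; exists (1 - r)^-1 => A.
have [N hN] : exists N, forall i, i \in A -> (i < N)%N.
  exists (\max_(i <- A) i).+1 => i iA; rewrite ltnS.
  by rewrite (big_rem i) //= leq_maxl.
apply: (@le_trans _ _ (\sum_(i < N) r ^+ i)).
  rewrite -(big_mkord xpredT (fun i => r ^+ i)).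
  rewrite [leRHS](bigID (mem A)) /= /psum -[leLHS]addr0; apply: lerD; last first.
    by apply: sumr_ge0 => i _; apply: exprn_ge0.
  rewrite -big_filter le_eqVlt; apply/orP; left; apply/eqP.
  apply: perm_big; apply: uniq_perm => //; first exact: filter_uniq (iota_uniq _ _).
  move=> i; rewrite mem_filter mem_index_iota /=.
  by case: (boolP (i \in A)) => //= /hN ->.
have r1' : 0 < 1 - r by rewrite subr_gt0.
rewrite -(ler_pM2l r1') mulfV ?gt_eqF // -opprB mulNr -subrX1 opprB.
by rewrite lerBlDr lerDl exprn_ge0.
Qed.

Lemma bounded_psum_geoZ (r : K) : 0 <= r -> r < 1 -> bounded_psum (fun n : int => r ^+ absz n).
Proof.
move=> r0 r1; apply: bounded_psum_int => /=; first exact: bounded_psum_geo.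
apply: (@bounded_psum_le _ _ (fun n => r * r ^+ n));
  last by apply: bounded_psumZ => //; exact: bounded_psum_geo.
by move=> n; rewrite -exprS.
Qed.

End AbsB.

(** * Summability over the real and the complex numbers *)

Lemma sumcomplete_pos {R : realType} {I : choiceType} (g : I -> R) :
  bounded_psum g -> (forall i, 0 <= g i) -> exists S, hassum g S.
Proof.
move=> [M hM] g0; pose E : set R := range (psum g).
have supE : has_sup E.
  split; first by exists (psum g fset0); exists fset0.
  by exists M => _ [A _ <-]; exact: hM.
exists (sup E); apply/hassumP => e e0.
have [_ [A _ <-] HA] := sup_adherent e0 supE.
exists A => B AB.
have h1 : psum g A <= psum g B.
  by rewrite (psum_sub _ AB) lerDl; apply: sumr_ge0.
have h2 : psum g B <= sup E by apply: sup_ubound; [exact: supE.2|exists B].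
rewrite ger0_norm; lra.
Qed.

Lemma sumcomplete_real (R : realType) : sumcomplete R.
Proof.
move=> I F g gb Fg.
have nb : bounded_psum (fun i => `|F i|) by apply: bounded_psum_le gb => i; exact: Fg.
have [S1 h1] := sumcomplete_pos nb (fun i => normr_ge0 _).
have [||S2 h2] := @sumcomplete_pos _ _ (fun i => F i + `|F i|).
- apply: (@bounded_psum_le _ _ _ (fun i => `|F i| + `|F i|)); last exact: bounded_psumD.
  by move=> i; rewrite lerD2r ler_norm.
- by move=> i; rewrite addrC -lerBlDr sub0r -normrN ler_norm.
exists (S2 + (-1) * S1).
apply: (hassum_ext (hassumD h2 (hassumZ (-1) h1))) => i /=; ring.
Qed.

Section ComplexSums.
Context {R : realType}.
Local Notation C := (CC R).

Lemma normC_real (x : R) : `|x%:C : C| = `|x|%:C.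
Proof. by rewrite normc_def /= expr0n /= addr0 sqrtr_sqr. Qed.

Lemma gt0_complexE (e : C) : 0 < e -> e = (complex.Re e)%:C /\ 0 < complex.Re e.
Proof. by case: e => a b; rewrite ltcE /= => /andP[/eqP -> ->]. Qed.

Lemma hassum_realC {I : choiceType} (f : I -> R) s :
  hassum f s -> hassum (fun i => (f i)%:C : C) s%:C.
Proof.
move=> /hassumP h; apply/hassumP => e /gt0_complexE[-> e0].
have [A HA] := h _ e0; exists A => B /HA.
rewrite -[psum (K := C) _ _](rmorph_sum (real_complex R)) -rmorphB normC_real ltcR.
exact.
Qed.

Lemma sumcomplete_complex : sumcomplete C.
Proof.
move=> I F g [M gb] Fg.
have Rg i : complex.Re `|F i| <= complex.Re (g i).
  by have := Fg i; rewrite lecE => /andP[].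
have gbR : bounded_psum (fun i => complex.Re (g i)).
  exists (complex.Re M) => A; have := gb A; rewrite lecE => /andP[_].
  by rewrite /psum raddf_sum.
have ReF i : `|complex.Re (F i)| <= complex.Re (g i).
  apply: le_trans (Rg i).
  by have := normc_ge_Re (F i); rewrite lecE => /andP[].
have ImF i : `|complex.Im (F i)| <= complex.Re (g i).
  apply: le_trans (Rg i).
  have := normc_ge_Re (F i * 'i).
  by rewrite ReiNIm normrN normrM normCi mulr1 lecE => /andP[].
have [S1 h1] := sumcomplete_real gbR ReF.
have [S2 h2] := sumcomplete_real gbR ImF.
exists (S1%:C + 'i * S2%:C).
apply: (hassum_ext (hassumD (hassum_realC h1) (hassumZ 'i (hassum_realC h2)))) => i /=.
by rewrite -complexE.
Qed.

End ComplexSums.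

(** * Finite theta quotients *)

Definition poch {F : fieldType} (a q : F) (n : nat) : F := \prod_(k < n) (1 - a * q ^+ k).

(* The terms of the theta series with nome [q = p ^+ 2]; working with a square root of the nome
   avoids the exponent k(k+1)/2. *)
Definition theta_term {F : fieldType} (p z : F) (k : int) : F := (- z) ^ k * p ^ (k * (k + 1)).

Section Algebra.
Context {F : fieldType}.
Implicit Types (p q x y z : F).

Lemma size_prod_1subZX (I : finType) (Q : pred I) (b : I -> F) :
  (size (\prod_(i | Q i) (1 - b i *: 'X))%R <= #|Q|.+1)%N.
Proof.
rewrite -sum1_card.
apply: (big_ind2 (fun (r : {poly F}) m => (size r <= m.+1)%N)).
- by rewrite size_poly1.
- move=> r1 m1 r2 m2 h1 h2; apply: leq_trans (size_polyMleq _ _) _.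
  by rewrite -subn1 leq_subLR; apply: leq_trans (leq_add h1 h2) _; rewrite addSn addnS.
move=> j _; apply: leq_trans (size_polyD _ _) _; rewrite geq_max size_poly1 /=.
by rewrite size_polyN (leq_trans (size_scale_leq _ _)) // size_polyX.
Qed.

Lemma expz_sqr p k : (p ^+ 2) ^ k = p ^ (2 * k).
Proof. by rewrite exprnP exprz_exp. Qed.

(** Lagrange interpolation: [P] and the interpolant [L] have size at most [#|I|] and agree at the
    [#|I|] distinct points [(b i)^-1], hence are equal; dividing by the product of all [1 - b i * x]
    gives the expansion. *)
Lemma partial_fractions (I : finType) (b : I -> F) (P : {poly F}) x :
  (forall i, b i != 0) -> injective b -> (size P <= #|I|)%N ->
  (forall i, 1 - b i * x != 0) ->
  P.[x] / \prod_i (1 - b i * x) =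
  \sum_i P.[(b i)^-1] / (\prod_(j | j != i) (1 - b j / b i) * (1 - b i * x)).
Proof.
move=> b0 bI sP bx.
pose l i : {poly F} := \prod_(j | j != i) (1 - b j *: 'X).
have lE i y : (l i).[y] = \prod_(j | j != i) (1 - b j * y).
  by rewrite horner_prod; apply: eq_bigr => j _; rewrite !hornerE.
have nz i : \prod_(j | j != i) (1 - b j / b i) != 0.
  apply/prodf_neq0 => j ji; rewrite subr_eq0 eq_sym.
  by apply: contra ji => /eqP h; apply/eqP/bI/(divIf (b0 i)); rewrite h divff.
pose L := \sum_i (P.[(b i)^-1] / \prod_(j | j != i) (1 - b j / b i)) *: l i.
have sl i : (size (l i) <= #|I|)%N.
  apply: leq_trans (size_prod_1subZX _ _) _; rewrite (cardC1 i) prednK //.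
  by apply/card_gt0P; exists i.
have PL : P = L.
  apply/eqP; rewrite -subr_eq0; apply/eqP.
  apply: (@roots_geq_poly_eq0 _ _ [seq (b i)^-1 | i <- enum I]).
  - apply/allP => _ /mapP[i _ ->]; rewrite rootE hornerD hornerN horner_sum.
    rewrite (bigD1 i) //= [X in _ - (_ + X)]big1 ?addr0; last first.
      move=> j ji; rewrite hornerZ lE [X in _ * X](bigD1 i) 1?eq_sym //= divff // subrr.
      by rewrite mul0r mulr0.
    by rewrite hornerZ lE divfK // subrr.
  - by rewrite map_inj_uniq ?enum_uniq // => i j /invr_inj/bI.
  rewrite size_map -cardE; apply: leq_trans (size_polyD _ _) _.
  rewrite geq_max sP size_polyN /=; apply: leq_trans (size_sum _ _ _) _.
  apply/bigmax_leqP => i _; exact: leq_trans (size_scale_leq _ _) (sl i).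
rewrite {1}PL horner_sum mulr_suml; apply: eq_bigr => i _.
rewrite hornerZ lE [in LHS](bigD1 (P := xpredT) i) //=.
have n2 : \prod_(j | j != i) (1 - b j * x) != 0 by apply/prodf_neq0.
have := bx i; have := nz i.
by move: (\prod_(_ | _) _) n2 => u u0; move: (\prod_(_ | _) _) => v v0 w0; field; rewrite u0 v0 w0.
Qed.

(** * The q-binomial theorem and the finite triple product *)

Definition qbin q n i : F := if (i <= n)%N then poch q q n / (poch q q i * poch q q (n - i)) else 0.

Lemma pochS (a q : F) n : poch a q n.+1 = poch a q n * (1 - a * q ^+ n).
Proof. by rewrite /poch big_ord_recr. Qed.

Lemma poch_neq0 (a q : F) n : (forall k, a * q ^+ k != 1) -> poch a q n != 0.
Proof. by move=> H; apply/prodf_neq0 => k _; rewrite subr_eq0 eq_sym. Qed.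

(** The inner product is [(-y)^i q^(i(i-1)/2)], written without halving an exponent. Induction on
    [n], with the q-Pascal rule [rec]; the last term of that rule collects into
    [- y * q ^+ n * poch y q n]. *)
Lemma qbinomial q y n : (forall k, q ^+ k.+1 != 1) ->
  poch y q n = \sum_(i < n.+1) qbin q n i * \prod_(t < i) (- y * q ^+ t).
Proof.
move=> hq.
have nz m : poch q q m != 0 by apply: poch_neq0 => k; rewrite -exprS.
have P0 : poch q q 0 = 1 by rewrite /poch big_ord0.
elim: n => [|n IH]; first by rewrite big_ord1 /qbin /= big_ord0 !P0 /poch big_ord0 !(mulr1, invr1).
have rec i : (i < n.+1)%N -> qbin q n.+1 i.+1 = qbin q n i.+1 + q ^+ (n - i) * qbin q n i.
  move=> lin; rewrite /qbin ltnS -ltnS lin subSS.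
  move: lin; rewrite ltnS leq_eqVlt => /orP[/eqP ->|lin].
    by rewrite ltnn subnn P0 add0r mul1r; field; rewrite !nz.
  rewrite lin.
  have -> : (n - i = (n - i.+1).+1)%N by lia.
  have h1 := nz i.+1; have h2 := nz (n - i.+1).+1.
  have -> : poch q q n.+1 = poch q q n * (1 - q ^+ i.+1 * q ^+ (n - i.+1).+1).
    by rewrite pochS -exprS -exprD; congr (_ * (1 - q ^+ _)); lia.
  rewrite !pochS -!exprS in h1 h2 *.
  move: h1 h2; rewrite !mulf_eq0 !negb_or => /andP[a1 a2] /andP[a3 a4].
  by field; rewrite a1 a2 a3 a4.
rewrite big_ord_recl /= {1}/qbin /= subn0 !P0 big_ord0 mul1r divff // mul1r.
under eq_bigr => i _ do rewrite /bump /= add1n rec // mulrDl.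
rewrite big_split /= addrA.
have -> : 1 + \sum_(i < n.+1) qbin q n i.+1 * \prod_(t < i.+1) (- y * q ^+ t) = poch y q n.
  rewrite IH -[RHS]addr0; transitivity (\sum_(i < n.+2) qbin q n i * \prod_(t < i) (- y * q ^+ t)).
    by rewrite [RHS]big_ord_recl /= /qbin /= subn0 !P0 big_ord0 mul1r divff // mul1r.
  by rewrite big_ord_recr /= {2}/qbin ltnn mul0r.
have -> : \sum_(i < n.+1) q ^+ (n - i) * qbin q n i * \prod_(t < i.+1) (- y * q ^+ t)
    = - y * q ^+ n * poch y q n.
  rewrite IH mulr_sumr; apply: eq_bigr => i _; rewrite big_ord_recr /=.
  have -> : q ^+ n = q ^+ (n - i) * q ^+ i by rewrite -exprD subnK // -ltnS.
  ring.
by rewrite pochS; ring.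
Qed.

(** The factors with [m >= i] form [poch z q j]. In the others, [1 - z / q^(t+1) = (- z / q^(t+1))
    (1 - q^(t+1) / z)] turns negative powers of [q] into positive ones, so that what remains
    converges as the truncation grows. *)
Lemma poch_center q z i j : q != 0 -> z != 0 ->
  \prod_(0 <= m < i + j) (1 - q ^ (m%:Z - i%:Z) * z) =
  poch z q j * poch (q / z) q i * \prod_(t < i) (- z / q ^+ t.+1).
Proof.
move=> q0 z0; rewrite (@big_cat_nat _ _ _ i) ?leq_addr //= mulrC -mulrA; congr (_ * _).
  rewrite -{1}(add0n i) big_addn addKn /poch big_mkord.
  apply: eq_bigr => m _; rewrite mulrC; congr (1 - z * _).
  by rewrite exprnP; congr (q ^ _); lia.
rewrite /poch -big_split /= big_nat_rev /= big_mkord; apply: eq_bigr => t _.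
rewrite add0n (_ : (i - t.+1)%N%:Z - i%:Z = - t.+1%:Z); last by case: t => t /= ?; lia.
rewrite -exprnN exprS; have qt : q ^+ t != 0 by rewrite expf_neq0.
by field; rewrite qt q0 z0.
Qed.

(** The companion of [poch_center] at [z = 1], with the vanishing factor [m = i] left out: this is
    the product over the other poles of the same family in a residue. *)
Lemma poch_center1 q i j : q != 0 ->
  \prod_(0 <= m < i + j.+1 | m != i) (1 - q ^ (m%:Z - i%:Z)) =
  poch q q j * poch q q i * \prod_(t < i) (- (1 / q ^+ t.+1)).
Proof.
move=> q0; rewrite (@big_cat_nat _ _ _ i) ?leq_addr //= mulrC -mulrA; congr (_ * _).
  rewrite big_ltn_cond; last by lia.
  rewrite eqxx /= -{1}[i.+1]add0n big_addn.
  have -> : (i + j.+1 - i.+1 = j)%N by lia.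
  rewrite /poch big_mkord big_mkcond /=; apply: eq_bigr => m _.
  have -> : (m + i.+1 != i)%N by lia.
  by rewrite -exprS exprnP; congr (1 - q ^ _); lia.
rewrite big_nat_cond (eq_bigl (fun m => (0 <= m < i)%N && true)); last first.
  by move=> m; case: ltngtP; rewrite ?andbF.
rewrite -big_nat_cond.
rewrite /poch -big_split /= big_nat_rev /= big_mkord; apply: eq_bigr => t _.
rewrite add0n (_ : (i - t.+1)%N%:Z - i%:Z = - t.+1%:Z); last by case: t => t /= ?; lia.
rewrite -exprnN exprS; have qt : q ^+ t != 0 by rewrite expf_neq0.
by field; rewrite qt q0.
Qed.

Lemma prod_qneg p z i : p != 0 -> z != 0 ->
  \prod_(t < i) (- z / (p ^+ 2) ^+ t.+1) = (- z) ^ i%:Z * p ^ (- (i%:Z * (i%:Z + 1))).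
Proof.
move=> p0 z0; elim: i => [|i IH]; first by rewrite big_ord0 mul0r oppr0 !expr0z mulr1.
rewrite big_ord_recr /= IH -exprM exprnN.
have -> : (- z) ^ (i.+1)%:Z = (- z) ^ i * (- z) by rewrite -exprnP exprSr.
have -> : p ^ (- (i.+1%:Z * (i.+1%:Z + 1))) = p ^ (- (i%:Z * (i%:Z + 1))) * p ^ (- (2 * i.+1)%N%:Z).
  by rewrite -expfzDr //; congr (p ^ _); rewrite PoszM; lia.
by ring.
Qed.

(** By [poch_center] the left side is, up to a monomial, the single product
    [poch (q ^ (- N) * (q * z)) q (N + N)], to which the q-binomial theorem applies. The monomial
    recenters the summation index at [N]. *)
Lemma finite_triple_product p z N : p != 0 -> z != 0 -> (forall k, (p ^+ 2) ^+ k.+1 != 1) ->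
  poch (p ^+ 2 * z) (p ^+ 2) N * poch z^-1 (p ^+ 2) N =
  \sum_(i < (N + N).+1) qbin (p ^+ 2) (N + N) i * theta_term p z (i%:Z - N%:Z).
Proof.
move=> p0 z0 hq; set q := p ^+ 2; have q0 : q != 0 by rewrite expf_neq0.
have qz0 : q * z != 0 by rewrite mulf_neq0.
have := poch_center N N q0 qz0; rewrite prod_qneg //.
have -> : q / (q * z) = z^-1 by field; rewrite q0 z0.
set W := _ * p ^ _ => H.
have W0 : W != 0 by rewrite mulf_neq0 // expfz_neq0 // oppr_eq0.
apply: (mulIf W0); rewrite -H mulr_suml.
transitivity (poch (q ^ (- N%:Z) * (q * z)) q (N + N)).
  rewrite /poch big_mkord; apply: eq_bigr => m _.
  by rewrite expfzDr // -exprnP; congr (1 - _); ring.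
rewrite qbinomial //; apply: eq_bigr => i _; rewrite -[RHS]mulrA; congr (_ * _).
rewrite /theta_term /W; elim: (i : nat) => [|n IH].
  rewrite big_ord0 add0r.
  have -> : (- (q * z)) ^ N%:Z = (- z) ^ N%:Z * p ^ (N%:Z * 2).
    by rewrite -mulrN expfzMl expz_sqr mulrC [2 * _]mulrC.
  transitivity (((- z) ^ (- N%:Z) * (- z) ^ N%:Z) *
    (p ^ (- N%:Z * (- N%:Z + 1)) * p ^ (N%:Z * 2) * p ^ (- (N%:Z * (N%:Z + 1))))); last by ring.
  rewrite -!expfzDr ?oppr_eq0 // addNr expr0z mul1r -[LHS](expr0z p).
  by congr (p ^ _); ring.
rewrite big_ord_recr /= IH.
have -> : n.+1%:Z - N%:Z = (n%:Z - N%:Z) + 1 by lia.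
set k := n%:Z - N%:Z.
have -> : (- z) ^ (k + 1) = (- z) ^ k * - z by rewrite expfzDr ?oppr_eq0 // expr1z.
have -> : p ^ ((k + 1) * (k + 1 + 1)) = p ^ (k * (k + 1)) * p ^ (2 * (k + 1)).
  by rewrite -expfzDr //; congr (p ^ _); ring.
have -> : - (q ^ (- N%:Z) * (q * z)) * q ^+ n = - z * p ^ (2 * (k + 1)).
  rewrite mulNr mulNr; congr (- _); rewrite mulrA mulrAC [RHS]mulrC; congr (_ * _).
  rewrite (exprnP q n) -[X in _ * X * _](expr1z q) -!expfzDr // /q expz_sqr.
  by congr (p ^ _); rewrite /k; ring.
by ring.
Qed.

(** * Interpolation of the truncated theta quotient *)

Definition ptheta q x N : F := poch x q N * poch (q / x) q N.

(* [residue q z0 z1 N i * theta_term p z1 (i - N)] is the coefficient of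
   [1 / (1 - q^(i - N) x z1)] in the partial fraction expansion of the truncated quotient. *)
Definition residue q z0 z1 N i : F :=
  poch z0 q (N + N - i) * poch (q / z0) q i /
  (poch (z0 / z1) q (N + N - i) * poch (q * z1 / z0) q i
   * (poch q q (N + N - i.+1) * poch q q i)).

Lemma big_bool_pair n (G : bool * 'I_n -> F) :
  \prod_p G p = \prod_i G (true, i) * \prod_i G (false, i).
Proof.
rewrite -(big_bool _ (fun c => \prod_i G (c, i))) pair_big /=.
by apply: eq_bigr => -[].
Qed.

Lemma sum_bool_pair n (G : bool * 'I_n -> F) :
  \sum_p G p = \sum_i G (true, i) + \sum_i G (false, i).
Proof.
rewrite -(big_bool _ (fun c => \sum_i G (c, i))) pair_big /=.
by apply: eq_bigr => -[].
Qed.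

Lemma big_bool_pairD1 n (G : bool * 'I_n -> F) c i :
  \prod_(p | p != (c, i)) G p = \prod_j G (~~ c, j) * \prod_(j | j != i) G (c, j).
Proof.
rewrite big_mkcond big_bool_pair /= [\prod_(j | j != i) _]big_mkcond /=.
case: c => /=; rewrite 1?mulrC; congr (_ * _); apply: eq_bigr => j _;
  by rewrite xpair_eqE /=.
Qed.

Lemma expN1zN k : (-1 : F) ^ (- k) = (-1) ^ k.
Proof. by rewrite -exprz_inv invrN1. Qed.

Section Finite.
Variables (p x z0 z1 : F) (N : nat).
Let q := p ^+ 2.
Hypotheses (p0 : p != 0) (x0 : x != 0) (z00 : z0 != 0) (z10 : z1 != 0) (N0 : (0 < N)%N).
Hypothesis hq : forall k : int, k != 0 -> q ^ k != 1.
Hypothesis hz : forall k : int, q ^ k * z0 != z1.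
Hypothesis hx0 : forall k : int, q ^ k * (x * z0) != 1.
Hypothesis hx1 : forall k : int, q ^ k * (x * z1) != 1.

(** The first factor is the interpolated numerator at one pole divided by the denominator factors of
    all other poles; the product over [t] is a normalization common to all poles. It is stated for
    free [y0], [y1] because the two families of poles exchange the roles of [z0] and [z1]. *)
Lemma residueE y0 y1 (i : 'I_(N + N)) : y0 != 0 -> y1 != 0 ->
  ((y1 * q ^ (i%:Z - N%:Z))^-1 ^+ N *
    \prod_(0 <= m < N + N) (1 - y0 * y1 * q ^ (m%:Z - N%:Z) * (y1 * q ^ (i%:Z - N%:Z))^-1))
  / (\prod_(0 <= m < N + N) (1 - y0 * q ^ (m%:Z - N%:Z) / (y1 * q ^ (i%:Z - N%:Z)))
     * \prod_(0 <= m < N + N | m != i) (1 - y1 * q ^ (m%:Z - N%:Z) / (y1 * q ^ (i%:Z - N%:Z))))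
  * \prod_(t < N) (- 1 / q ^+ t.+1)
  = residue q y0 y1 N i * theta_term p y1 (i%:Z - N%:Z).
Proof.
move=> y00 y10; set k := i%:Z - N%:Z; have q0 : q != 0 by rewrite expf_neq0.
have qz (m : int) : q ^ m != 0 by rewrite expfz_neq0.
have E1 : (N + N = i + (N + N - i))%N by have := ltn_ord i; lia.
have E2 : (N + N = i + (N + N - i.+1).+1)%N by have := ltn_ord i; lia.
have mi (m : nat) : q ^ (m%:Z - N%:Z) = q ^ (m%:Z - i%:Z) * q ^ k.
  by rewrite -expfzDr //; congr (q ^ _); rewrite /k; ring.
have -> : \prod_(0 <= m < N + N) (1 - y0 * y1 * q ^ (m%:Z - N%:Z) * (y1 * q ^ k)^-1)
    = poch y0 q (N + N - i) * poch (q / y0) q i * ((- y0) ^ i%:Z * p ^ (- (i%:Z * (i%:Z + 1)))).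
  rewrite -prod_qneg // -poch_center // -E1; apply: eq_bigr => m _.
  by rewrite mi; congr (1 - _); field; rewrite y10 qz.
have -> : \prod_(0 <= m < N + N) (1 - y0 * q ^ (m%:Z - N%:Z) / (y1 * q ^ k))
    = poch (y0 / y1) q (N + N - i) * poch (q * y1 / y0) q i
      * ((- (y0 / y1)) ^ i%:Z * p ^ (- (i%:Z * (i%:Z + 1)))).
  have y01 : y0 / y1 != 0 by rewrite mulf_neq0 ?invr_eq0.
  have -> : q * y1 / y0 = q / (y0 / y1) by field; rewrite y00 y10.
  rewrite -prod_qneg // -poch_center // -E1; apply: eq_bigr => m _.
  by rewrite mi; congr (1 - _); field; rewrite y10 qz.
have -> : \prod_(0 <= m < N + N | m != i) (1 - y1 * q ^ (m%:Z - N%:Z) / (y1 * q ^ k))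
    = poch q q (N + N - i.+1) * poch q q i * ((- 1) ^ i%:Z * p ^ (- (i%:Z * (i%:Z + 1)))).
  rewrite -prod_qneg ?oner_eq0 //.
  have -> : \prod_(t < i) (- 1 / p ^+ 2 ^+ t.+1) = \prod_(t < i) (- (1 / q ^+ t.+1)).
    by apply: eq_bigr => t _; rewrite mulNr.
  rewrite -poch_center1 // -E2; apply: eq_bigr => m _.
  by rewrite mi; congr (1 - _); field; rewrite y10 qz.
rewrite prod_qneg ?oner_eq0 //.
have -> : (- y0) ^ i%:Z = (- (y0 / y1)) ^ i%:Z * y1 ^ i%:Z.
  by rewrite -expfzMl; congr (_ ^ _); field.
rewrite /residue /theta_term.
have H : (y1 * q ^ k)^-1 ^+ N * y1 ^ i%:Z * ((- 1) ^ N%:Z * p ^ (- (N%:Z * (N%:Z + 1))))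
   = ((- y1) ^ k * p ^ (k * (k + 1))) * ((- 1) ^ i%:Z * p ^ (- (i%:Z * (i%:Z + 1)))).
  have -> : (y1 * q ^ k)^-1 ^+ N = y1 ^ (- N%:Z) * p ^ (- (2 * k * N%:Z)).
    rewrite exprVn exprnP invr_expz expfzMl expz_sqr exprz_exp.
    by congr (_ * p ^ _); ring.
  have -> : (- y1) ^ k = (-1) ^ i%:Z * (-1) ^ N%:Z * (y1 ^ i%:Z * y1 ^ (- N%:Z)).
    rewrite (_ : - y1 = -1 * y1) ?mulN1r // -[- y1]mulN1r expfzMl -(expfzDr _ _ y10); congr (_ * _).
    by rewrite /k expfzDr ?expN1zN // oppr_eq0 oner_eq0.
  have -> : p ^ (k * (k + 1)) = p ^ (- (2 * k * N%:Z)) * p ^ (- (N%:Z * (N%:Z + 1))) * p ^ (i%:Z * (i%:Z + 1)).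
    by rewrite -!expfzDr //; congr (p ^ _); rewrite /k; ring.
  have h1 : (-1 : F) ^ i%:Z * (-1) ^ i%:Z = 1.
    by rewrite -expfzMl mulrNN mulr1 exp1rz.
  have h2 : p ^ (i%:Z * (i%:Z + 1)) * p ^ (- (i%:Z * (i%:Z + 1))) = 1.
    by rewrite -expfzDr // subrr expr0z.
  transitivity (y1 ^ (- N%:Z) * p ^ (- (2 * k * N%:Z)) * y1 ^ i%:Z * ((-1) ^ N%:Z * p ^ (- (N%:Z * (N%:Z + 1)))) *
    (((-1 : F) ^ i%:Z * (-1) ^ i%:Z) * (p ^ (i%:Z * (i%:Z + 1)) * p ^ (- (i%:Z * (i%:Z + 1)))))).
    by rewrite h1 h2 !mulr1.
  by ring.
have Wi : (- 1) ^ i%:Z * p ^ (- (i%:Z * (i%:Z + 1))) != 0 :> F.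
  by rewrite mulf_neq0 // expfz_neq0 // oppr_eq0 oner_eq0.
have V : (- (y0 / y1)) ^ i%:Z * p ^ (- (i%:Z * (i%:Z + 1))) != 0.
  by rewrite mulf_neq0 // expfz_neq0 // oppr_eq0 mulf_neq0 ?invr_eq0.
have -> : (- y1) ^ k * p ^ (k * (k + 1)) = (y1 * q ^ k)^-1 ^+ N * y1 ^ i%:Z
    * ((- 1) ^ N%:Z * p ^ (- (N%:Z * (N%:Z + 1)))) / ((- 1) ^ i%:Z * p ^ (- (i%:Z * (i%:Z + 1)))).
  by rewrite H mulfK.
rewrite -(mulrAC _ _ (y1 ^ i)).
move: V Wi (poch y0 _ _ * _) (poch (y0 / y1) _ _ * _) (poch q _ _ * _).
move: (_ * p ^ _) => V; move: (_ * p ^ _) => Wi V0 Wi0 a b c.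
rewrite !invfM; move: (b^-1) (c^-1) => b' c'.
by field; rewrite V0 Wi0.
Qed.

Lemma finite_theta_identity :
  ptheta q (x * z0 * z1) N / (ptheta q (x * z0) N * ptheta q (x * z1) N) =
  \sum_(i < N + N) residue q z0 z1 N i * theta_term p z1 (i%:Z - N%:Z)
     / (1 - q ^ (i%:Z - N%:Z) * (x * z1)) +
  \sum_(i < N + N) residue q z1 z0 N i * theta_term p z0 (i%:Z - N%:Z)
     / (1 - q ^ (i%:Z - N%:Z) * (x * z0)).
Proof.
have q0 : q != 0 by rewrite expf_neq0.
have qz (m : int) : q ^ m != 0 by rewrite expfz_neq0.
(* The inverses of the poles in [x], the boolean telling the two truncated theta functions apart.
   They are distinct within a family by [hq] and across families by [hz]. *)
pose b (c : bool * 'I_(N + N)) := (if c.1 then z1 else z0) * q ^ (c.2%:Z - N%:Z).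
(* The denominators are centered at [m = N], and the factor ['X^N] compensates for this in the
   numerator; as [0 < N], the degree 3N stays below the number 4N of poles. *)
pose P : {poly F} := 'X^N * \prod_(m < N + N) (1 - (z0 * z1 * q ^ (m%:Z - N%:Z)) *: 'X).
have PE y : P.[y] = y ^+ N * \prod_(0 <= m < N + N) (1 - z0 * z1 * q ^ (m%:Z - N%:Z) * y).
  rewrite hornerM hornerXn horner_prod big_mkord; congr (_ * _).
  by apply: eq_bigr => m _; rewrite !hornerE.
have b0 i : b i != 0 by rewrite mulf_neq0 //; case: i.1.
have inj1 (m m' : 'I_(N + N)) : q ^ (m%:Z - N%:Z) = q ^ (m'%:Z - N%:Z) -> m = m'.
  move=> h; apply/val_inj/eqP; apply: contraT => mm.
  have : m%:Z - m'%:Z != 0 by rewrite subr_eq0.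
  move=> /hq; have -> : m%:Z - m'%:Z = (m%:Z - N%:Z) + - (m'%:Z - N%:Z) by ring.
  by rewrite expfzDr // h -expfzDr // subrr expr0z eqxx.
have no (m m' : 'I_(N + N)) : z0 * q ^ (m%:Z - N%:Z) = z1 * q ^ (m'%:Z - N%:Z) -> False.
  move=> h; have /eqP := hz ((m%:Z - N%:Z) + - (m'%:Z - N%:Z)); apply.
  by rewrite expfzDr // mulrAC [_ * z0]mulrC h -mulrA -expfzDr // subrr expr0z mulr1.
have bI : injective b.
  move=> [[] m] [[] m'] /=; rewrite /b /=.
  - by move/(mulfI z10)/inj1 ->.
  - by move/esym/no.
  - by move/no.
  - by move/(mulfI z00)/inj1 ->.
have sP : (size P <= #|{: bool * 'I_(N + N)}|)%N.
  rewrite card_prod card_bool card_ord.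
  apply: leq_trans (size_polyMleq _ _) _; rewrite size_polyXn addSn /=.
  apply: (@leq_trans (N + (N + N).+1)); last by lia.
  rewrite leq_add2l.
  by apply: leq_trans (size_prod_1subZX _ _) _; rewrite card_ord.
have bx i : 1 - b i * x != 0.
  case: i => -[] i; rewrite subr_eq0 eq_sym /b /=.
    by rewrite -mulrA mulrCA [z1 * x]mulrC; exact: hx1.
  by rewrite -mulrA mulrCA [z0 * x]mulrC; exact: hx0.
have W0 : \prod_(t < N) (- 1 / q ^+ t.+1) != 0 :> F.
  apply/prodf_neq0 => t _; rewrite mulf_neq0 ?oppr_eq0 ?oner_eq0 // invr_eq0.
  by rewrite expf_neq0.
have := partial_fractions b0 bI sP bx.
move/(congr1 (fun y => y * \prod_(t < N) (- 1 / q ^+ t.+1))).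
have cen a : a != 0 -> \prod_(i < N + N) (1 - a * q ^ (i%:Z - N%:Z) * x) =
    ptheta q (x * a) N * ((- (x * a)) ^ N%:Z * p ^ (- (N%:Z * (N%:Z + 1)))).
  move=> a0; rewrite -prod_qneg ?mulf_neq0 // -poch_center ?mulf_neq0 // big_mkord.
  by apply: eq_bigr => i _; congr (1 - _); ring.
rewrite big_bool_pair /b /= !cen // PE big_mkord.
rewrite cen ?mulf_neq0 // prod_qneg ?oner_eq0 // mulrA => H.
transitivity (x ^+ N * ptheta q (x * (z0 * z1)) N * ((- (x * (z0 * z1))) ^ N%:Z * p ^ (- (N%:Z * (N%:Z + 1)))) /
  (ptheta q (x * z1) N * ((- (x * z1)) ^ N%:Z * p ^ (- (N%:Z * (N%:Z + 1)))) *
   (ptheta q (x * z0) N * ((- (x * z0)) ^ N%:Z * p ^ (- (N%:Z * (N%:Z + 1))))))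
  * ((- 1) ^ N%:Z * p ^ (- (N%:Z * (N%:Z + 1))))).
  rewrite mulrA.
  have n1 : (- (x * z1)) ^ N%:Z != 0 by rewrite expfz_neq0 // oppr_eq0 mulf_neq0.
  have n2 : (- (x * z0)) ^ N%:Z != 0 by rewrite expfz_neq0 // oppr_eq0 mulf_neq0.
  have n3 : p ^ (- (N%:Z * (N%:Z + 1))) != 0 by rewrite expfz_neq0.
  (* The monomials left by recentering the three products cancel exactly; the factor [x ^+ N]
     supplied by ['X^N] balances the degree in [x]. *)
  have E : x ^+ N * (- (x * z0 * z1)) ^ N%:Z * (-1) ^ N%:Z = (- (x * z1)) ^ N%:Z * (- (x * z0)) ^ N.
    by rewrite exprnP -!expfzMl; congr (_ ^ _); ring.
  move: E n1 n2 n3; move: ((- (x * z1)) ^ N%:Z) ((- (x * z0)) ^ N%:Z) ((-1) ^ N%:Z : F).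
  move: ((- (x * z0 * z1)) ^ N%:Z) (p ^ _) (ptheta q (x * z0 * z1) N) (ptheta q (x * z0) N).
  move: (ptheta q _ N) (x ^+ N) => t1 y u3 u5 t2 t3 u1 u2 u4 E n1 n2 n3.
  transitivity (t2 / (t3 * t1) * ((y * u3 * u4) / (u1 * u2))).
    by rewrite E divff ?mulf_neq0 // mulr1.
  by rewrite !invfM; move: (t1^-1) (t3^-1) => t1' t3'; field; rewrite n1 n2 n3.
rewrite H -prod_qneg ?oner_eq0 //.
have dE (a d w c : F) : a / (d * w) * c = a / d * c / w by rewrite invfM mulrA mulrAC.
rewrite sum_bool_pair /= mulrDl !mulr_suml; congr (_ + _); apply: eq_bigr => i _.
  rewrite big_bool_pairD1 /= PE -residueE // !big_mkord.
  rewrite dE; congr (_ / _); ring.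
rewrite big_bool_pairD1 /= PE -residueE // !big_mkord.
under [X in _ = _ * X / _ * _ / _]eq_bigr do rewrite [z1 * z0]mulrC.
rewrite dE; congr (_ / _); ring.
Qed.

End Finite.
End Algebra.

(** * Infinite products and Appell sums *)

Lemma big_ord_fset {K : numFieldType} n (F : nat -> K) :
  \sum_(k < n) F k = psum F [fset k in iota 0 n]%fset.
Proof.
rewrite -(big_mkord xpredT F) /psum; apply: perm_big; apply: uniq_perm.
- exact: iota_uniq.
- exact: fset_uniq.
by move=> i; rewrite mem_index_iota !inE mem_iota.
Qed.

Lemma prod_ord_fset {K : numFieldType} n (F : nat -> K) :
  \prod_(k < n) F k = \prod_(k <- [fset k in iota 0 n]%fset) F k.
Proof.
rewrite -(big_mkord xpredT F); apply: perm_big; apply: uniq_perm.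
- exact: iota_uniq.
- exact: fset_uniq.
by move=> i; rewrite mem_index_iota !inE mem_iota.
Qed.

Lemma hassum_series {K : numFieldType} (F : nat -> K) S :
  hassum F S -> (fun n => \sum_(k < n) F k) @ \oo --> S.
Proof.
move=> /hassumP h; apply/cvgrPdist_lt => e e0; have [A HA] := h e e0.
exists (\max_(i <- A) i).+1 => // n /= hn; rewrite big_ord_fset; apply: HA.
apply/fsubsetP => i iA; rewrite !inE mem_iota /= add0n.
by apply: leq_trans hn; rewrite ltnS (big_rem i) //= leq_maxl.
Qed.

Lemma cvg_oo_comp {T : topologicalType} (u : nat -> T) (l : T) (f : nat -> nat) (c : nat) :
  (forall N, (N <= f N + c)%N) -> u @ \oo --> l -> (fun N => u (f N)) @ \oo --> l.
Proof.
move=> hf h; apply: (cvg_comp _ _ _ h) => A [M _ MA].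
by exists (M + c)%N => // n /= hn; apply: MA => /=; have := hf n; lia.
Qed.

Lemma cvg_oo_addl {T : topologicalType} (u : nat -> T) (l : T) (c : int) :
  u @ \oo --> l -> (fun N : nat => u (absz (N%:Z + c))) @ \oo --> l.
Proof. by apply: (@cvg_oo_comp _ _ _ _ (absz c)) => N; lia. Qed.

Lemma cvg_eq_gt0 {K : numFieldType} (u v : nat -> K) (a b : K) :
  u @ \oo --> a -> v @ \oo --> b -> (forall N, (0 < N)%N -> u N = v N) -> a = b.
Proof.
move=> ua vb uv; suff ub : u @ \oo --> b by exact: (cvg_unique _ ua ub).
have h : \forall N \near \oo, v N = u N by exists 1%N => // N /= /uv ->.
exact: cvg_trans (near_eq_cvg h) vb.
Qed.

Section Limits.
Context {K : numFieldType} (Kc : sumcomplete K).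

(** By induction, the product of the [1 + g i] times [1 - sum g i] is at most 1. Off a finite set
    the sum is at most 1/2, so the product there is at most 2. *)
Lemma prod_bounded_psum {I : choiceType} (g : I -> K) : bounded_psum g -> (forall i, 0 <= g i) ->
  exists B, forall A : {fset I}, \prod_(i <- A) (1 + g i) <= B.
Proof.
move=> gb g0; have h2 : 0 < 1 / 2 :> K by rewrite divr_gt0.
have [A0 HA] := bounded_psum_tail Kc gb g0 h2.
have pge (s : seq I) : 0 <= \prod_(i <- s) (1 + g i).
  by apply: prodr_ge0 => i _; apply: addr_ge0.
have pge1 (s : seq I) : 1 <= \prod_(i <- s) (1 + g i).
  elim: s => [|i s IH]; rewrite ?big_nil // big_cons.
  by apply: mulr_ege1 => //; rewrite lerDl.
have key (s : seq I) : \prod_(i <- s) (1 + g i) * (1 - \sum_(i <- s) g i) <= 1.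
  elim: s => [|i s IH]; first by rewrite !big_nil subr0 mulr1.
  rewrite !big_cons; apply: le_trans IH.
  rewrite [_ * \prod_(_ <- _) _]mulrC -mulrA; apply: ler_wpM2l => //.
  rewrite -subr_ge0; have -> : 1 - \sum_(j <- s) g j - (1 + g i) * (1 - (g i + \sum_(j <- s) g j))
     = g i * (g i + \sum_(j <- s) g j) by ring.
  by rewrite mulr_ge0 // addr_ge0 // sumr_ge0.
exists ((\prod_(i <- A0) (1 + g i)) * 2) => A.
rewrite (big_fsetID _ (mem A0) A) /=; apply: ler_pM => //.
  rewrite [leRHS](big_fsetID _ (mem A) A0) /=.
  rewrite -[leLHS]mulr1; apply: ler_pM => //.
  rewrite le_eqVlt; apply/orP; left; apply/eqP; apply: eq_fbigl => i.
  by rewrite !inE /= andbC.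
have AD : [disjoint A0 & [fset x | x in A & x \notin A0]]%fset.
  by apply/fdisjointP => i iA; rewrite !inE /= iA andbF.
have h := HA _ AD; have := key [fset x | x in A & x \notin A0]%fset.
set P := \prod_(_ <- _) _ => kP.
have : P * (1 / 2) <= 1.
  apply: le_trans kP; apply: ler_wpM2l; first exact: pge.
  by rewrite lerBrDr -lerBrDl; apply: le_trans h _; rewrite lerBrDr -mulrDl divff.
by rewrite mul1r ler_pdivrMr // mul1r.
Qed.

(** Outside a finite set [|u i| <= 1 / 2], which bounds the inverse by 2; the finitely many other
    inverses are bounded by their sum. *)
Lemma inv1sub_bounded {I : choiceType} (u : I -> K) : bounded_psum (fun i => `|u i|) ->
  (forall i, u i != 1) -> exists2 C : K, 0 <= C & forall i, `|(1 - u i)^-1| <= C.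
Proof.
move=> ub u1; have h2 : 0 < 1 / 2 :> K by rewrite divr_gt0.
have [A HA] := bounded_psum_tail Kc ub (fun i => normr_ge0 _) h2.
have s0 : 0 <= \sum_(i <- A) `|(1 - u i)^-1| by apply: sumr_ge0.
exists (\sum_(i <- A) `|(1 - u i)^-1| + 2) => [|i]; first by rewrite addr_ge0.
case: (boolP (i \in A)) => iA.
  by rewrite (big_fsetD1 i) //= -addrA lerDl addr_ge0 // sumr_ge0.
have : `|u i| <= 1 / 2.
  have := HA [fset i]%fset; rewrite /psum big_seq_fset1; apply.
  by apply/fdisjointP => j jA; rewrite inE; apply: contraNneq iA => <-.
move=> ui; apply: (@le_trans _ _ 2); last by rewrite lerDr.
have h : 1 / 2 <= `|1 - u i|.
  apply: le_trans (lerB_dist _ _); rewrite normr1 lerBrDr -lerBrDl.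
  by apply: le_trans ui _; rewrite lerBrDr -mulrDl divff.
rewrite normrV ?unitfE ?subr_eq0 1?eq_sym //.
rewrite -[leRHS]invrK lef_pV2 ?posrE ?invr_gt0 //; first by rewrite -[2^-1]mul1r.
by rewrite normr_gt0 subr_eq0 eq_sym.
Qed.

(** * Infinite q-products *)

Section Poch.
Context {q : K} (q1 : `|q| < 1).

Lemma bounded_psum_geoq (a : K) : bounded_psum (fun k : nat => `|a * q ^+ k|).
Proof.
apply: (@bounded_psum_le _ _ _ (fun k => `|a| * `|q| ^+ k)).
  by move=> k; rewrite normrM normrX.
by apply: bounded_psumZ => //; apply: bounded_psum_geo.
Qed.

Lemma poch_bounded a : exists2 B : K, 0 <= B & forall n, `|poch a q n| <= B.
Proof.
have [B HB] := prod_bounded_psum (bounded_psum_geoq a) (fun i => normr_ge0 _).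
have H n : `|poch a q n| <= B.
  apply: le_trans (HB [fset k in iota 0 n]%fset); rewrite -prod_ord_fset /poch normr_prod.
  apply: ler_prod => k _; rewrite normr_ge0 /=.
  by apply: le_trans (ler_normB _ _) _; rewrite normr1.
by exists B => //; exact: le_trans (H 0%N).
Qed.

Lemma pochV_bounded a : (forall k : nat, a * q ^+ k != 1) ->
  exists2 B : K, 0 <= B & forall n, `|(poch a q n)^-1| <= B.
Proof.
move=> a1; have [C C0 HC] := inv1sub_bounded (bounded_psum_geoq a) a1.
have gb := bounded_psumZ C0 (bounded_psum_geoq a).
have [B HB] := prod_bounded_psum gb (fun i => mulr_ge0 C0 (normr_ge0 _)).
have H n : `|(poch a q n)^-1| <= B.
  apply: le_trans (HB [fset k in iota 0 n]%fset).
  rewrite -(prod_ord_fset _ (fun k => 1 + C * `|a * q ^+ k|)) /poch -prodfV normr_prod.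
  apply: ler_prod => k _; rewrite normr_ge0 /=.
  have k1 : 1 - a * q ^+ k != 0 by rewrite subr_eq0 eq_sym.
  (* This turns the product of inverses into a product of factors [1 + u] with summable [u], so the
     bound for ordinary products applies again. *)
  have -> : (1 - a * q ^+ k)^-1 = 1 + (1 - a * q ^+ k)^-1 * (a * q ^+ k).
    by apply: (mulfI k1); rewrite mulrDr mulVKf // mulfV // mulr1 subrK.
  apply: le_trans (ler_normD _ _) _; rewrite normr1 lerD2l normrM.
  exact: ler_wpM2r.
by exists B => //; exact: le_trans (H 0%N).
Qed.

Definition pochoo a : K := lim (poch a q @ \oo).

(** The increments of the partial products are [- poch a q n * (a * q ^+ n)], which are summable
    because [poch a q n] is bounded; the limit is then a telescoping sum. *)
Lemma poch_cvg a : poch a q @ \oo --> pochoo a.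
Proof.
have [B B0 HB] := poch_bounded a.
have gb := bounded_psumZ B0 (bounded_psum_geoq a).
have [|S hS] := Kc gb (F := fun n => poch a q n.+1 - poch a q n).
  move=> n; have -> : poch a q n.+1 - poch a q n = - (poch a q n * (a * q ^+ n)) by rewrite pochS; ring.
  rewrite normrN normrM.
  exact: ler_wpM2r.
suff h : poch a q @ \oo --> 1 + S by rewrite /pochoo (cvg_lim _ h).
have -> : poch a q = (fun n => 1 + \sum_(k < n) (poch a q k.+1 - poch a q k)).
  apply/funext => n; rewrite -(big_mkord xpredT (fun k => poch a q k.+1 - poch a q k)).
  rewrite telescope_sumr //; have -> : poch a q 0 = 1 by rewrite /poch big_ord0.
  by rewrite addrC subrK.
apply: cvgD; [exact: cvg_cst|exact: (hassum_series hS)].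
Qed.

Lemma pochoo_unique a (l : K) : poch a q @ \oo --> l -> pochoo a = l.
Proof. by move=> h; exact: (cvg_unique _ (@poch_cvg a) h). Qed.

(** A zero limit would make the inverses of the finite products unbounded, contrary to
    [pochV_bounded]. *)
Lemma pochoo_neq0 a : (forall k : nat, a * q ^+ k != 1) -> pochoo a != 0.
Proof.
move=> a1; have [B B0 HB] := pochV_bounded a1.
apply/eqP => p0; have := @poch_cvg a; rewrite p0 => /cvgrPdist_lt/(_ (B + 1)^-1).
have B1 : 0 < B + 1 by apply: ltr_wpDl.
rewrite invr_gt0 => /(_ B1)[n _ /(_ n (leqnn n))]; rewrite sub0r normrN => h.
have pn : poch a q n != 0 by apply: poch_neq0.
have := HB n; rewrite normrV ?unitfE //.
have h' : B + 1 < `|poch a q n|^-1.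
  by rewrite -[ltLHS]invrK ltf_pV2 ?posrE ?invr_gt0 // normr_gt0.
by move/(lt_le_trans h'); rewrite -subr_gt0 opprD addNKr ltr0N1.
Qed.

Lemma pochooS a : pochoo a = (1 - a) * pochoo (a * q).
Proof.
apply: pochoo_unique; rewrite -(cvg_shiftS (poch a q)).
have -> : (fun n => poch a q n.+1) = (fun n => (1 - a) * poch (a * q) q n).
  apply/funext => n; rewrite /poch big_ord_recl expr0 mulr1; congr (_ * _).
  by apply: eq_bigr => i _; rewrite lift0 exprS mulrA.
by apply: cvgM; [exact: cvg_cst|exact: poch_cvg].
Qed.

Definition theta_poch x : K := pochoo x * pochoo (q / x).

Lemma theta_poch_inv u : u != 0 -> q != 0 -> theta_poch u^-1 = - theta_poch u / u.
Proof.
move=> u0 q0; rewrite /theta_poch invrK (pochooS u) (pochooS u^-1) [u^-1 * q]mulrC [u * q]mulrC.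
by field.
Qed.

Lemma theta_poch_neq0 u : u != 0 -> q != 0 -> (forall k : int, q ^ k != u) -> theta_poch u != 0.
Proof.
move=> u0 q0 H; rewrite mulf_neq0 //; apply: pochoo_neq0 => k.
  have := H (- k%:Z); apply: contraNneq => h; rewrite -exprnN.
  by apply/eqP/(mulIf (expf_neq0 k q0)); rewrite mulVf ?expf_neq0.
have := H (k.+1%:Z); apply: contraNneq => h; rewrite -exprnP exprS.
by apply/eqP; rewrite -[RHS]mul1r -h; field.
Qed.

End Poch.

(** Tannery's theorem for sums centered at [N]: the [N]-th sum becomes a family on all of [int] in
    the variable [k = i - N], extended by zero, and dominated convergence applies. *)
Lemma cvg_sum_centered (f : nat -> nat -> K) (G g : int -> K) (m : nat -> nat) (c : nat) S :
  (forall N, m N = (N + N + c)%N) ->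
  bounded_psum g -> (forall k, `|G k| <= g k) ->
  (forall N i, (i < m N)%N -> `|f N i| <= g (i%:Z - N%:Z)) ->
  (forall k, (fun N => f N (absz (N%:Z + k))) @ \oo --> G k) -> hassum G S ->
  (fun N => \sum_(i < m N) f N i) @ \oo --> S.
Proof.
move=> /funext -> gb Gg fg fG GS.
have g0 k : 0 <= g k := le_trans (normr_ge0 _) (Gg k).
pose F N (k : int) := if (0 <= N%:Z + k) && (N%:Z + k < (N + N + c)%N) then f N (absz (N%:Z + k)) else 0.
apply: (hassum_dominated Kc gb Gg (F := F)) GS.
- near=> N => k; rewrite /F; case: ifP => [/andP[h1 h2]|_]; last by rewrite normr0.
  apply: le_trans (fg _ _ _) _; first by lia.
  by rewrite le_eqVlt; apply/orP; left; apply/eqP; congr g; lia.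
- move=> k; apply: cvg_trans (fG k); apply: near_eq_cvg.
  near=> N; rewrite /F ifT //.
  have : (absz k < N)%N by near: N; exists (absz k).+1.
  lia.
near=> N; have := @hassum_fset K _ (F N) [fset (i%:Z - N%:Z) | i in iota 0 (N + N + c)]%fset.
rewrite /psum big_imfset /= ?undup_id ?iota_uniq //; last by move=> i j _ _; lia.
have -> : \sum_(i <- iota 0 (N + N + c)) F N (i%:Z - N%:Z) = \sum_(i < N + N + c) f N i.
  rewrite -(big_mkord xpredT (f N)) /index_iota subn0 big_seq [RHS]big_seq.
  apply: eq_bigr => i; rewrite mem_iota => hi; rewrite /F ifT; last by lia.
  by congr f; lia.
apply => k; rewrite /F; case: ifP => // h /imfsetP[]; exists (absz (N%:Z + k)) => /=.
  by rewrite mem_iota; lia.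
by lia.
Unshelve. all: by end_near. Qed.

(** * The triple product and the change of variable in Appell sums *)

Section Identities.
Context {p : K} (p0 : p != 0) (p1 : `|p| < 1).
Let q : K := p ^+ 2.

Lemma q_neq0 : q != 0. Proof. by rewrite expf_neq0. Qed.

Lemma q_lt1 : `|q| < 1. Proof. by rewrite normrX exprn_ilt1. Qed.

Lemma q_not_unity (k : int) : k != 0 -> q ^ k != 1.
Proof.
have h n : q ^+ n.+1 != 1.
  apply/eqP => /(congr1 Num.norm); rewrite normrX normr1 => h.
  have : `|q| ^+ n.+1 < 1 by rewrite exprn_ilt1 ?q_lt1.
  by rewrite h ltxx.
case: k => [[|n]|n] // _; first by rewrite -exprnP.
by rewrite NegzE -exprnN invr_eq1.
Qed.

Lemma bounded_psum_theta_term z : z != 0 -> bounded_psum (fun k => `|theta_term p z k|).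
Proof.
(* The left side times [2^n] is the product of the factors [2 |c| |p|^(2(j+1))], which is bounded
   since these factors are summable. Both signs of the index use this, with [c = z] and [c = z^-1],
   as [k(k+1) = n(n+1)] for [k = -(n+1)]. *)
have key (c : K) : exists2 B : K, 0 <= B &
    forall n : nat, `|c| ^+ n * `|p| ^+ (n * n.+1) <= B * (1 / 2) ^+ n.
  have r1 : `|p| ^+ 2 < 1 by rewrite exprn_ilt1.
  have c0 : 0 <= `|c| * 2 by rewrite mulr_ge0.
  have gb := bounded_psumZ c0 (bounded_psum_geo (exprn_ge0 2 (normr_ge0 p)) r1).
  have g0 (i : nat) : 0 <= `|c| * 2 * (`|p| ^+ 2) ^+ i by rewrite mulr_ge0 ?exprn_ge0.
  have [B HB] := prod_bounded_psum gb g0.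
  have B0 : 0 <= B by have := HB fset0; rewrite big_nil; apply: le_trans.
  exists B => // n; rewrite expr_div_n expr1n mulrA mulr1 ler_pdivlMr ?exprn_gt0 //.
  have -> : `|c| ^+ n * `|p| ^+ (n * n.+1) * 2 ^+ n
      = \prod_(j < n) (`|c| * 2 * (`|p| ^+ 2) ^+ j.+1).
    elim: n => [|n IH]; first by rewrite big_ord0 !expr0 !mulr1.
    rewrite big_ord_recr /= -IH -exprM.
    have -> : (n.+1 * n.+2 = n * n.+1 + 2 * n.+1)%N by lia.
    by rewrite exprD !exprS; ring.
  apply: le_trans (HB [fset k in iota 0 n]%fset).
  rewrite -(prod_ord_fset _ (fun k => 1 + `|c| * 2 * (`|p| ^+ 2) ^+ k)).
  apply: ler_prod => j _; rewrite mulr_ge0 ?exprn_ge0 //=.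
  apply: ler_wpDl => //; apply: ler_wpM2l => //; rewrite exprS.
  by apply: ler_piMl; rewrite ?exprn_ge0 // ltW.
move=> z0; apply: bounded_psum_int.
  have [B B0 HB] := key z; apply: (@bounded_psum_le _ _ _ (fun n => B * (1 / 2) ^+ n)).
    move=> n; apply: le_trans (HB n).
    have -> : theta_term p z n%:Z = (- z) ^+ n * p ^+ (n * n.+1).
      by rewrite /theta_term !exprnP; congr (_ * p ^ _); rewrite PoszM; lia.
    by rewrite normrM !normrX normrN.
  apply: bounded_psumZ => //; apply: bounded_psum_geo; first by rewrite divr_ge0.
  by rewrite ltr_pdivrMr // mul1r ltr1n.
have [B B0 HB] := key z^-1; apply: (@bounded_psum_le _ _ _ (fun n => `|z|^-1 * (B * (1 / 2) ^+ n))).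
  move=> n; apply: le_trans (ler_wpM2l _ (HB n)); rewrite ?invr_ge0 //.
  have -> : theta_term p z (- n.+1%:Z) = (- z)^-1 * ((- z)^-1 ^+ n * p ^+ (n * n.+1)).
    rewrite /theta_term -exprnN exprS exprVn invfM mulrA [p ^+ _]exprnP; congr (_ * p ^ _).
    by rewrite PoszM; lia.
  by rewrite !normrM !normrX normrV ?unitfE ?oppr_eq0 // normrN normrV ?unitfE.
apply: bounded_psumZ; first by rewrite invr_ge0.
apply: bounded_psumZ => //; apply: bounded_psum_geo; first by rewrite divr_ge0.
by rewrite ltr_pdivrMr // mul1r ltr1n.
Qed.

Lemma pochoo_q_neq0 : pochoo (q := q) q != 0.
Proof.
apply: (pochoo_neq0 q_lt1) => k; rewrite -exprS.
exact: (@q_not_unity k.+1).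
Qed.

Lemma jacobi_triple_product z : z != 0 ->
  hassum (theta_term p z) (pochoo (q := q) q * theta_poch (q := q) z^-1).
Proof.
move=> z0.
have hq k : q * q ^+ k != 1 by rewrite -exprS; exact: (@q_not_unity k.+1).
have hq' k : q ^+ k.+1 != 1 by exact: (@q_not_unity k.+1).
have [S hS] := Kc (bounded_psum_theta_term z0) (fun k => lexx _).
have [B B0 HB] := poch_bounded q_lt1 q.
have [C C0 HC] := pochV_bounded q_lt1 hq.
have nz := pochoo_q_neq0.
have poc c : (fun N => poch q q (absz (N%:Z + c))) @ \oo --> pochoo (q := q) q.
  by apply: cvg_oo_addl; exact: poch_cvg q_lt1 _.
have h : (fun N => \sum_(i < N + N + 1) qbin q (N + N) i * theta_term p z (i%:Z - N%:Z)) @ \oo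
    --> (pochoo (q := q) q)^-1 * S.
  (* One majorant has to dominate both the truncated terms and their limits, whence the sum of the
     bound [B * C * C] for [qbin] and the modulus of its limit. *)
  apply: (@cvg_sum_centered (fun N i => qbin q (N + N) i * theta_term p z (i%:Z - N%:Z)) _
     (fun k => (B * C * C + `|(pochoo (q := q) q)^-1|) * `|theta_term p z k|) (fun N => N + N + 1)%N 1 _ _ _ _ _ _
     (hassumZ (pochoo (q := q) q)^-1 hS)).
  - by [].
  - apply: bounded_psumZ (bounded_psum_theta_term z0); rewrite addr_ge0 ?mulr_ge0 //.
  - move=> k; rewrite normrM; apply: ler_wpM2r => //.
    by rewrite lerDr !mulr_ge0.
  - move=> N i; rewrite addn1 => iN; rewrite normrM; apply: ler_wpM2r => //.
    apply: ler_wpDr => //; rewrite /qbin -ltnS iN normrM invfM normrM -mulrA.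
    by apply: ler_pM => //; apply: ler_pM.
  move=> k.
  apply: (@cvg_trans _ ((fun N : nat => poch q q (N + N) / (poch q q (absz (N%:Z + k))
      * poch q q (absz (N%:Z - k))) * theta_term p z k) @ \oo)).
    apply: near_eq_cvg; near=> N.
    have hN : (absz k < N)%N by near: N; exists (absz k).+1.
    rewrite /qbin ifT; last by lia.
    by congr (_ / (_ * poch q q _) * theta_term p z _); lia.
  have -> : (pochoo (q := q) q)^-1 = pochoo (q := q) q / (pochoo (q := q) q * pochoo (q := q) q).
    by field.
  apply: cvgM; last exact: cvg_cst.
  apply: cvgM.
    by apply: (@cvg_oo_comp _ (poch q q) _ (fun N => N + N)%N 0) => [N|]; [lia|exact: poch_cvg q_lt1 q].
  apply: cvgV; first by rewrite mulf_neq0.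
  exact: cvgM.
have h2 : (fun N => poch (q * z) q N * poch z^-1 q N) @ \oo
    --> pochoo (q := q) (q * z) * pochoo (q := q) z^-1.
  by apply: cvgM; exact: poch_cvg q_lt1 _.
have E : (pochoo (q := q) q)^-1 * S = pochoo (q := q) (q * z) * pochoo (q := q) z^-1.
  by apply: (cvg_eq_gt0 h h2) => N _; rewrite finite_triple_product // addn1.
suff -> : pochoo (q := q) q * theta_poch (q := q) z^-1 = S by [].
by rewrite /theta_poch invrK [pochoo z^-1 * _]mulrC -E mulVKf.
Unshelve. all: by end_near. Qed.

Lemma inv1sub_int a : a != 0 -> (forall k : int, q ^ k * a != 1) ->
  exists2 C : K, 0 <= C & forall k : int, `|(1 - q ^ k * a)^-1| <= C.
Proof.
move=> a0 ha.
have [|C C0 HC] := inv1sub_bounded (bounded_psum_geoq q_lt1 a).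
  by move=> k; rewrite mulrC; exact: (ha k%:Z).
have [|D D0 HD] := inv1sub_bounded (bounded_psum_geoq q_lt1 a^-1).
  move=> k; have := ha (- k%:Z); rewrite -exprnN; apply: contraNneq => h.
  by rewrite -invr_eq1 invfM invrK mulrC h.
exists (C + `|a^-1| * D) => [|k]; first by rewrite addr_ge0 ?mulr_ge0.
case: k => n.
  by apply: ler_wpDr; rewrite ?mulr_ge0 // mulrC; exact: HC.
apply: ler_wpDl => //; rewrite NegzE -exprnN.
have qn : q ^+ n.+1 != 0 by rewrite expf_neq0 // q_neq0.
have qa : 1 - a^-1 * q ^+ n.+1 != 0.
  have := ha (- n.+1%:Z); rewrite -exprnN subr_eq0 eq_sym; apply: contraNneq => h.
  rewrite eq_sym.
  by rewrite -invr_eq1 invfM invrK mulrC h.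
(* For negative exponents [q^k a] grows, so the fraction is rewritten in [a^-1 q^(n+1)], which tends
   to 0. *)
have -> : (1 - q ^- n.+1 * a)^-1 = - (a^-1 * q ^+ n.+1 * (1 - a^-1 * q ^+ n.+1)^-1).
  have qa' : a - q ^+ n.+1 != 0.
    by have := mulf_neq0 a0 qa; rewrite mulrBr mulr1 mulrA mulfV // mul1r.
  by field; rewrite a0 qn qa' -oppr_eq0 opprB qa'.
rewrite normrN !normrM -mulrA; apply: ler_wpM2l => //.
rewrite -[leRHS]mul1r; apply: ler_pM => //.
by rewrite normrX; apply: exprn_ile1 => //; apply: ltW; exact: q_lt1.
Qed.

Lemma ler_norm_mul3 (a b c A C : K) : `|a| <= A -> `|c| <= C -> `|a * b * c| <= A * C * `|b|.
Proof. by move=> hA hC; rewrite !normrM mulrAC; apply: ler_wpM2r => //; apply: ler_pM. Qed.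

Section Residues.
Context {z0 z1 : K} (z00 : z0 != 0) (z10 : z1 != 0) (hz : forall k : int, q ^ k * z0 != z1).

Let quot_ne1 (k : nat) : z0 / z1 * q ^+ k != 1.
Proof.
have := hz k; rewrite exprnP; apply: contraNneq => h.
by rewrite -[z1 in X in _ == X]mul1r -h; apply/eqP; field.
Qed.

Let quot'_ne1 (k : nat) : q * z1 / z0 * q ^+ k != 1.
Proof.
have qk : q ^+ k.+1 != 0 by rewrite expf_neq0 // q_neq0.
have := hz (- k.+1%:Z); rewrite -exprnN; apply: contraNneq => h.
apply/eqP/(mulfI qk); rewrite mulVKf // exprS -[LHS]mul1r -h; field; exact: z00.
Qed.

Lemma residue_bounded : exists2 B : K, 0 <= B & forall N i, `|residue q z0 z1 N i| <= B.
Proof.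
have [B0 b0 H0] := poch_bounded q_lt1 z0.
have [B1 b1 H1] := poch_bounded q_lt1 (q / z0).
have [C0 c0 G0] := pochV_bounded q_lt1 quot_ne1.
have [C1 c1 G1] := pochV_bounded q_lt1 quot'_ne1.
have [|C2 c2 G2] := @pochV_bounded q q_lt1 q.
  by move=> k; rewrite -exprS; exact: (@q_not_unity k.+1).
exists (B0 * B1 * (C0 * C1 * (C2 * C2))) => [|N i]; first by rewrite !mulr_ge0.
rewrite /residue !invfM !normrM.
by do ![apply: ler_pM => //; rewrite ?mulr_ge0 //].
Qed.

(** The limit does not depend on [k], so in the limit of the interpolation identity it factors out
    and leaves a pure Appell sum. *)
Lemma residue_cvg (k : int) : (fun N => residue q z0 z1 N (absz (N%:Z + k))) @ \oo
  --> theta_poch (q := q) z0 / (theta_poch (q := q) (z0 / z1) * (pochoo (q := q) q * pochoo (q := q) q)).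
Proof.
have pc a c : (fun N => poch a q (absz (N%:Z + c))) @ \oo --> pochoo (q := q) a.
  by apply: cvg_oo_addl; exact: poch_cvg q_lt1 _.
apply: (@cvg_trans _ ((fun N : nat => poch z0 q (absz (N%:Z - k)) * poch (q / z0) q (absz (N%:Z + k)) /
  (poch (z0 / z1) q (absz (N%:Z - k)) * poch (q * z1 / z0) q (absz (N%:Z + k))
   * (poch q q (absz (N%:Z + (- k - 1))) * poch q q (absz (N%:Z + k))))) @ \oo)).
  apply: near_eq_cvg; near=> N.
  have hN : (absz k < N)%N by near: N; exists (absz k).+1.
  rewrite /residue.
  have -> : (N + N - absz (N%:Z + k)%R = absz (N%:Z - k)%R)%N by lia.
  by have -> : (N + N - (absz (N%:Z + k)%R).+1 = absz (N%:Z + (- k - 1))%R)%N by lia.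
have -> : theta_poch (q := q) (z0 / z1) = pochoo (q := q) (z0 / z1) * pochoo (q := q) (q * z1 / z0).
  by congr (_ * pochoo _); field; rewrite z00.
have n1 := pochoo_neq0 q_lt1 quot_ne1; have n2 := pochoo_neq0 q_lt1 quot'_ne1.
have n3 := pochoo_q_neq0.
apply: cvgM; first by apply: cvgM; exact: pc.
apply: cvgV; first by rewrite !mulf_neq0.
by apply: cvgM; apply: cvgM; exact: pc.
Unshelve. all: by end_near. Qed.

Lemma residue_sum_cvg a S : a != 0 -> (forall k : int, q ^ k * a != 1) ->
  hassum (fun k : int => theta_term p z1 k / (1 - q ^ k * a)) S ->
  (fun N => \sum_(i < N + N) residue q z0 z1 N i * theta_term p z1 (i%:Z - N%:Z)
     / (1 - q ^ (i%:Z - N%:Z) * a)) @ \oo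
  --> theta_poch (q := q) z0 / (theta_poch (q := q) (z0 / z1) * (pochoo (q := q) q * pochoo (q := q) q)) * S.
Proof.
move=> a0 ha hS; have [C C0 HC] := inv1sub_int a0 ha.
have [B B0 HB] := residue_bounded.
set L := theta_poch _ / _.
have := @cvg_sum_centered (fun N i => residue q z0 z1 N i * theta_term p z1 (i%:Z - N%:Z)
  / (1 - q ^ (i%:Z - N%:Z) * a)) _ (fun k => (B + `|L|) * C * `|theta_term p z1 k|) (fun N => N + N)%N 0 _ _ _ _ _ _
  (hassumZ L hS).
apply.
- by move=> N; rewrite addn0.
- by apply: bounded_psumZ (bounded_psum_theta_term z10); rewrite mulr_ge0 // addr_ge0.
- by move=> k; rewrite mulrA; apply: ler_norm_mul3 => //; rewrite lerDr.
- by move=> N i _; apply: ler_norm_mul3 => //; apply: ler_wpDr.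
move=> k; apply: (@cvg_trans _ ((fun N : nat => residue q z0 z1 N (absz (N%:Z + k))
   * (theta_term p z1 k / (1 - q ^ k * a))) @ \oo)).
  apply: near_eq_cvg; near=> N.
  have hN : (absz k < N)%N by near: N; exists (absz k).+1.
  have -> : (absz (N%:Z + k))%:Z - N%:Z = k by lia.
  by rewrite mulrA.
by apply: cvgM; [exact: residue_cvg|exact: cvg_cst].
Unshelve. all: by end_near. Qed.

End Residues.

Lemma hassum_appell_exists z a : z != 0 -> a != 0 -> (forall k : int, q ^ k * a != 1) ->
  exists S, hassum (fun k : int => theta_term p z k / (1 - q ^ k * a)) S.
Proof.
move=> z0 a0 ha; have [C C0 HC] := inv1sub_int a0 ha.
apply: (Kc (bounded_psumZ C0 (bounded_psum_theta_term z0))) => k.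
by rewrite normrM mulrC; apply: ler_wpM2r.
Qed.

(** The limit of [finite_theta_identity] as [N] grows; both limiting residues carry the inverse
    square of [pochoo q], which is moved to the left side. *)
Lemma appell_change x z0 z1 S0 S1 : x != 0 -> z0 != 0 -> z1 != 0 ->
  (forall k : int, q ^ k * z0 != z1) ->
  (forall k : int, q ^ k * (x * z0) != 1) -> (forall k : int, q ^ k * (x * z1) != 1) ->
  hassum (fun k : int => theta_term p z1 k / (1 - q ^ k * (x * z1))) S1 ->
  hassum (fun k : int => theta_term p z0 k / (1 - q ^ k * (x * z0))) S0 ->
  pochoo (q := q) q ^+ 2 * theta_poch (q := q) (x * z0 * z1)
    / (theta_poch (q := q) (x * z0) * theta_poch (q := q) (x * z1)) =
  theta_poch (q := q) z0 / theta_poch (q := q) (z0 / z1) * S1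
  + theta_poch (q := q) z1 / theta_poch (q := q) (z1 / z0) * S0.
Proof.
move=> x0 z00 z10 hz h0 h1 hS1 hS0.
have hz' (k : int) : q ^ k * z1 != z0.
  have qk : q ^ k != 0 by rewrite expfz_neq0 // q_neq0.
  have := hz (- k); apply: contraNneq => <-.
  by rewrite mulrA -expfzDr ?q_neq0 // addNr expr0z mul1r.
have nPi y : y != 0 -> (forall k : int, q ^ k * y != 1) -> theta_poch (q := q) y != 0.
  move=> y0 hy; apply: (theta_poch_neq0 q_lt1 y0 q_neq0) => k; have := hy (- k).
  apply: contraNneq => <-; by rewrite -expfzDr ?q_neq0 // addNr expr0z.
have xz0 : x * z0 != 0 by rewrite mulf_neq0.
have xz1 : x * z1 != 0 by rewrite mulf_neq0.
have c1 := residue_sum_cvg z00 z10 hz xz1 h1 hS1.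
have c0 := residue_sum_cvg z10 z00 hz' xz0 h0 hS0.
have pc y : (fun N => ptheta q y N) @ \oo --> theta_poch (q := q) y.
  by apply: cvgM; exact: poch_cvg q_lt1 _.
have cl : (fun N => ptheta q (x * z0 * z1) N / (ptheta q (x * z0) N * ptheta q (x * z1) N)) @ \oo
    --> theta_poch (q := q) (x * z0 * z1) / (theta_poch (q := q) (x * z0) * theta_poch (q := q) (x * z1)).
  apply: cvgM => //; apply: cvgV; first by rewrite mulf_neq0 // nPi.
  exact: cvgM.
have n0 := pochoo_q_neq0.
have E : theta_poch (q := q) (x * z0 * z1) / (theta_poch (q := q) (x * z0) * theta_poch (q := q) (x * z1)) =
   theta_poch (q := q) z0 / (theta_poch (q := q) (z0 / z1) * (pochoo (q := q) q * pochoo (q := q) q)) * S1 +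
   theta_poch (q := q) z1 / (theta_poch (q := q) (z1 / z0) * (pochoo (q := q) q * pochoo (q := q) q)) * S0.
  apply: (cvg_eq_gt0 cl (cvgD c1 c0)) => N N0.
  by rewrite finite_theta_identity //; exact: q_not_unity.
rewrite -mulrA E mulrDr; move: (theta_poch (q := q) (z0 / z1)) (theta_poch (q := q) (z1 / z0)) => u1 u2.
move: (theta_poch (q := q) z0) (theta_poch (q := q) z1) (pochoo (q := q) q) n0 => v1 v2 w w0.
by rewrite !invfM; move: (u1^-1) (u2^-1) => u1' u2'; field.
Qed.

End Identities.
End Limits.

(** * The change of elliptic variable *)

Section AbstractTheta.
Context {K : numFieldType} (Kc : sumcomplete K) {e : K -> K}.
(* [e] stands for [z |-> exp (2 pi i z)]; nothing else about it is used. *)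
Hypothesis eD : forall z w, e (z + w) = e z * e w.
Hypothesis e_half : e (1 / 2) = -1.
Hypothesis e_neq0 : forall z, e z != 0.
Hypothesis e_eq1 : forall z, e z = 1 -> exists m : int, z = m%:~R.
Implicit Types (z w : K).

Lemma e0 : e 0 = 1.
Proof. by apply: (mulfI (e_neq0 0)); rewrite -eD addr0 mulr1. Qed.

Lemma eN w : e (- w) = (e w)^-1.
Proof. by apply: (mulfI (e_neq0 w)); rewrite -eD subrr e0 mulfV. Qed.

Lemma eB z w : e (z - w) = e z / e w.
Proof. by rewrite eD eN. Qed.

Lemma eMz w (n : int) : e (n%:~R * w) = e w ^ n.
Proof.
have eMn (m : nat) : e (m%:R * w) = e w ^+ m.
  elim: m => [|m IH]; first by rewrite mul0r e0 expr0.
  by rewrite exprS -IH -eD; congr e; ring.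
case: n => n; first exact: eMn.
by rewrite NegzE -exprnN mulrNz mulNr eN eMn.
Qed.

Lemma e_int (m : int) : e m%:~R = 1.
Proof.
have e1 : e 1 = 1.
  have {1}-> : 1 = 1 / 2 + 1 / 2 :> K by field.
  by rewrite eD e_half mulrNN mulr1.
by rewrite -[m%:~R]mulr1 eMz e1 exp1rz.
Qed.

Lemma eDint z (m : int) : e (z + m%:~R) = e z.
Proof. by rewrite eD e_int mulr1. Qed.

Context {T : K} (T1 : `|e (T / 2)| < 1).
Let p : K := e (T / 2).
Let q : K := p ^+ 2.
Let p0 : p != 0 := e_neq0 (T / 2).
Let q0 : q != 0 := q_neq0 p0.
Let q1 : `|q| < 1 := q_lt1 T1.

Definition lattice z : Prop := exists a b : int, z = a%:~R * T + b%:~R.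

Lemma qE : q = e T.
Proof. by rewrite /q /p expr2 -eD; congr e; field. Qed.

Definition euler_product : K := pochoo (q := e (T / 2) ^+ 2) (e (T / 2) ^+ 2).
Definition theta_pochT (x : K) : K := theta_poch (q := e (T / 2) ^+ 2) x.
(** The exponential prefactor gathers the parts of [(n + 1/2)^2 T / 2 + (n + 1/2)(z + 1/2)] that do
    not depend on [n]; the rest of the theta series is the triple product at [e z]. *)
Definition theta_product z : K := e (T / 8 + z / 2 + 1 / 4) * (euler_product * theta_pochT (e (- z))).

Lemma theta_term_e z (n : int) : theta_term p (e z) n =
  e (n%:~R * (z + 1 / 2) + n%:~R * (n%:~R + 1) / 2 * T).
Proof.
rewrite /theta_term [RHS]eD eMz eD e_half mulrN1 /p -eMz; congr (_ * e _).
by rewrite rmorphM rmorphD /=; field.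
Qed.

Lemma hassum_theta_product z :
  hassum (fun n : int => e ((n%:~R + 1 / 2) ^+ 2 / 2 * T + (n%:~R + 1 / 2) * (z + 1 / 2)))
    (theta_product z).
Proof.
have h := jacobi_triple_product Kc p0 T1 (e_neq0 z).
rewrite /theta_product eN; apply: (hassum_ext (hassumZ (e (T / 8 + z / 2 + 1 / 4)) h)) => n.
by rewrite theta_term_e -eD; congr e; field.
Qed.

Lemma theta_product_shift z (l : int) :
  theta_product (z + l%:~R * T) = e (- (l%:~R ^+ 2 / 2 * T) - l%:~R * (z + 1 / 2)) * theta_product z.
Proof.
have H := @hassum_theta_product (z + l%:~R * T).
apply: (hassum_unique H).
have h := hassum_reindex (h := fun n : int => n + l) (h' := fun n => n - l)
  (fun n => addrK l n) (fun n => subrK l n) (@hassum_theta_product z).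
apply: (hassum_ext (hassumZ (e (- (l%:~R ^+ 2 / 2 * T) - l%:~R * (z + 1 / 2))) h)) => n /=.
by rewrite -eD; congr e; rewrite rmorphD /=; field.
Qed.

Lemma euler_product_neq0 : euler_product != 0.
Proof. by apply: (pochoo_q_neq0 Kc). Qed.

Lemma theta_pochT_neq0 z : ~ lattice z -> theta_pochT (e z) != 0.
Proof.
move=> hz; apply: (theta_poch_neq0 Kc q1 (e_neq0 z) q0) => k.
apply/eqP; rewrite qE -eMz => h; apply: hz.
have [m hm] : exists m : int, z - k%:~R * T = m%:~R.
  by apply: e_eq1; rewrite eB h mulfV.
by exists k, m; rewrite -hm addrC subrK.
Qed.

Lemma theta_pochT_inv z : theta_pochT (e (- z)) = - theta_pochT (e z) / e z.
Proof. by rewrite eN; exact: (theta_poch_inv Kc q1 (e_neq0 z) q0). Qed.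

Lemma qe_neq1 z (k : int) : ~ lattice z -> q ^ k * e z != 1.
Proof.
move=> hz; apply/eqP; rewrite qE -eMz -eD => /e_eq1[m hm]; apply: hz.
by exists (- k), m; rewrite -hm mulrNz; ring.
Qed.

Definition appell_sum z a S : Prop :=
  hassum (fun n : int => theta_term (e (T / 2)) (e z) n / (1 - (e (T / 2) ^+ 2) ^ n * e a)) S.

Lemma appell_sum_exists z a : ~ lattice a -> exists S, appell_sum z a S.
Proof.
move=> ha; apply: (hassum_appell_exists Kc p0 T1 (e_neq0 z) (e_neq0 a)) => k.
exact: qe_neq1.
Qed.

(** At [T / 2], replacing [n] by [-n] sends the theta term to [q^(-n)] times the term at
    [- (T / 2)], and inverting the denominator [1 - q^(-n) e(a)] yields the compensating [q^n]. The
    sign of [a] is thereby reversed, as needed for a common [x] in [appell_change]. *)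
Lemma appell_sum_opp a S : ~ lattice a -> appell_sum (T / 2) a S ->
  appell_sum (- (T / 2)) (- a) (- e a * S).
Proof.
move=> ha hS.
have h := hassum_reindex (h := fun n : int => - n) (h' := fun n => - n) (@opprK _) (@opprK _) hS.
apply: (hassum_ext (hassumZ (- e a) h)) => n /=.
rewrite -/p -/q !theta_term_e.
have qn : q ^ n != 0 by rewrite expfz_neq0.
have n1 : 1 - (q ^ n)^-1 * e a != 0.
  by rewrite subr_eq0 eq_sym invr_expz; exact: qe_neq1.
rewrite eN -[q ^ (- n)]invr_expz.
have -> : e ((- n)%:~R * (T / 2 + 1 / 2) + (- n)%:~R * ((- n)%:~R + 1) / 2 * T)
   = e (n%:~R * (- (T / 2) + 1 / 2) + n%:~R * (n%:~R + 1) / 2 * T) / q ^ n.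
  rewrite qE -eMz -eB -[RHS](eDint _ (- n)); congr e.
  by rewrite !mulrNz; field.
have n2 : q ^ n - e a != 0.
  by have := mulf_neq0 qn n1; rewrite mulrBr mulr1 mulrA mulfV // mul1r.
by field; rewrite e_neq0 qn n2 -oppr_eq0 opprB n2.
Qed.

(* [f3_boundary] for [y_2 = 0], in the variables [w_j = 3 z_j] and [T = 3 tau], with [SA] the Appell
   sum occurring in [mu]. *)
Definition closed_form w1 w2 SA : K :=
  e ((w2 - w1) / 2) * theta_product (w1 - T / 2 + 1 / 2) *
    (e ((w2 + 1 / 2) / 2) * SA / theta_product (T / 2))
  + e (1 / 4) * e ((w2 - w1) / 2) *
    ((e (T / 24) * euler_product) ^+ 3 * theta_product (w1 - w2 - T / 2) * theta_product (w1 + 1 / 2)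
     / (theta_product (w1 - w2) * theta_product (w2 + 1 / 2) * theta_product (T / 2))).

Hypothesis hT : ~ lattice (T / 2).

Lemma latticeN z : lattice (- z) -> lattice z.
Proof.
by move=> [a [b h]]; exists (- a), (- b); rewrite -[z]opprK h !mulrNz; ring.
Qed.

Lemma closed_formE w1 w2 S SA : ~ lattice (w1 - w2) -> ~ lattice (w2 + 1 / 2) ->
  ~ lattice (w1 + 1 / 2) -> appell_sum (w1 - T / 2 + 1 / 2) (w1 - w2) S ->
  appell_sum (T / 2) (w2 + 1 / 2) SA -> S = closed_form w1 w2 SA.
Proof.
move=> h12 h2 h1 hS hSA.
have hS0 := appell_sum_opp h2 hSA.
set Z0 := - (T / 2); set Z1 := w1 - T / 2 + 1 / 2; set X := - w2 + T / 2 - 1 / 2.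
have X0 : e X * e Z0 = e (- (w2 + 1 / 2)) by rewrite -eD; congr e; rewrite /X /Z0; ring.
have X1 : e X * e Z1 = e (w1 - w2) by rewrite -eD; congr e; rewrite /X /Z1; ring.
have X01 : e (- (w2 + 1 / 2)) * e Z1 = e (w1 - w2 - T / 2).
  by rewrite -!eD; congr e; rewrite /Z1; ring.
have nl2 : ~ lattice (- (w2 + 1 / 2)) by move/latticeN.
(* Since [Z1 - Z0 = w1 + 1 / 2], the condition separating the two families of poles is exactly
   [h1]. *)
have hz k : q ^ k * e Z0 != e Z1.
  apply/eqP; rewrite qE -eMz -eD => h; apply: h1.
  have [m hm] : exists m : int, k%:~R * T + Z0 - Z1 = m%:~R.
    by apply: e_eq1; rewrite eB h mulfV.
  by exists k, (- m); rewrite mulrNz -hm /Z0 /Z1; ring.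
have := appell_change Kc p0 T1 (e_neq0 X) (e_neq0 Z0) (e_neq0 Z1) hz.
rewrite X0 X1 X01 => /(_ (- e (w2 + 1 / 2) * SA) S).
move=> /(_ (fun k => qe_neq1 k nl2) (fun k => qe_neq1 k h12) hS hS0).
rewrite -/p -/q -!eB -/(theta_pochT _) -/euler_product.
have -> : Z1 - Z0 = w1 + 1 / 2 by rewrite /Z1 /Z0; ring.
have -> : Z0 - Z1 = - (w1 + 1 / 2) by rewrite /Z1 /Z0; ring.
rewrite -!/(theta_pochT _) -/euler_product !theta_pochT_inv => H.
have n1 := theta_pochT_neq0 h12; have n2 := theta_pochT_neq0 h2; have n3 := theta_pochT_neq0 h1.
have n4 := theta_pochT_neq0 hT.
have n5 := euler_product_neq0.
(* Every exponential that occurs is a monomial in these four values, so with [H] the claim becomes a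
   rational identity in which they are free nonzero variables. *)
set t := e (T / 8); set a := e (w1 / 2); set b := e (w2 / 2); set c := e (1 / 4).
have [t0 a0 b0 c0] : [/\ t != 0, a != 0, b != 0 & c != 0] by split; exact: e_neq0.
have eZ1 : e Z1 = a * a * c * c / (t * t * t * t).
  by rewrite /t /a /c -!eD -eB; congr e; rewrite /Z1; field.
have e2 : e (w2 + 1 / 2) = b * b * c * c.
  by rewrite /b /c -!eD; congr e; field.
have e1 : e (w1 + 1 / 2) = a * a * c * c.
  by rewrite /a /c -!eD; congr e; field.
have e12 : e (w1 - w2) = a * a / (b * b).
  by rewrite /a /b -!eD -eB; congr e; field.
have e12T : e (w1 - w2 - T / 2) = a * a / (b * b * (t * t * t * t)).
  by rewrite /a /b /t -!eD -eB; congr e; field.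
have eT : e (T / 2) = t * t * t * t by rewrite /t -!eD; congr e; field.
have f0 : e ((w2 - w1) / 2) = b / a by rewrite /a /b -eB; congr e; field.
have f1 : e (T / 8 + Z1 / 2 + 1 / 4) = a * c * c / t.
  by rewrite /a /c /t -!eD -eB; congr e; rewrite /Z1; field.
have f2 : e ((w2 + 1 / 2) / 2) = b * c by rewrite /b /c -!eD; congr e; field.
have f3 : e (T / 8 + T / 2 / 2 + 1 / 4) = t * t * t * c.
  by rewrite /t /c -!eD; congr e; field.
have f4 : e (T / 8 + (w1 - w2 - T / 2) / 2 + 1 / 4) = a * c / (b * t).
  by rewrite /a /b /c /t -!eD -eB; congr e; field.
have f5 : e (T / 8 + (w1 + 1 / 2) / 2 + 1 / 4) = a * t * c * c.
  by rewrite /a /c /t -!eD; congr e; field.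
have f6 : e (T / 8 + (w1 - w2) / 2 + 1 / 4) = a * t * c / b.
  by rewrite /a /b /c /t -!eD -eB; congr e; field.
have f7 : e (T / 8 + (w2 + 1 / 2) / 2 + 1 / 4) = b * t * c * c.
  by rewrite /b /c /t -!eD; congr e; field.
have f8 : e (T / 24) ^+ 3 = t by rewrite /t !exprS expr0 mulr1 -!eD; congr e; field.
rewrite /closed_form /theta_product !theta_pochT_inv -/Z1 f0 f1 f2 f3 f4 f5 f6 f7
  [(e _ * _) ^+ 3]exprMn f8 -/c.
move: H n1 n2 n3 n4 n5; rewrite eZ1 e2 e1 e12 e12T eT.
move: (theta_pochT _) (theta_pochT _) (theta_pochT _) (theta_pochT _) (theta_pochT _) (theta_pochT _)
  euler_product => x1 x2 x3 x4 x5 x6 x7 H n1 n2 n3 n4 n5.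
move: t a b c t0 a0 b0 c0 H {eZ1 e2 e1 e12 e12T eT f0 f1 f2 f3 f4 f5 f6 f7 f8} => t a b c t0 a0 b0 c0 H.
have -> : S = (x7 ^+ 2 * x6 / (- x5 / (b * b * c * c) * x4) - x1 / x2 * (- (b * b * c * c) * SA))
    / (- x3 / (t * t * t * t) / (- x2 / (a * a * c * c))).
  by rewrite H; field; rewrite t0 a0 c0 n3 n4.
by field; rewrite t0 a0 b0 c0 n1 n2 n3 n4 n5.
Qed.

(* The same for [y_2 = l v]. *)
Definition boundary_form w1 w2 (l : int) SA : K :=
  e (- (l%:~R * (l%:~R + 1) / 2 * T)) * e (- (w1 / 2)) * e ((l%:~R + 1 / 2) * w2) *
    theta_product (w1 - T / 2 + 1 / 2) *
    (e ((w2 - l%:~R * T + 1 / 2) / 2) * SA / theta_product (T / 2))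
  + e (1 / 4) * e ((w2 - w1) / 2) *
    ((e (T / 24) * euler_product) ^+ 3 * theta_product (w1 - w2 - T / 2) * theta_product (w1 + 1 / 2)
     / (theta_product (w1 - w2) * theta_product (w2 + 1 / 2) * theta_product (T / 2))).

(** The argument of [mu] already removes the shift by [l T], so only the three theta functions
    containing [w2] in the second summand contribute quasi-period factors; these combine with the
    prefactor to the same factor as in the first summand. *)
Lemma boundary_formE w1 w2 (l : int) SA :
  boundary_form w1 (w2 + l%:~R * T) l SA =
  e (l%:~R ^+ 2 / 2 * T + l%:~R * w2) * closed_form w1 w2 SA.
Proof.
rewrite /boundary_form /closed_form.
have -> : w2 + l%:~R * T - l%:~R * T + 1 / 2 = w2 + 1 / 2 by ring.
have -> : w1 - (w2 + l%:~R * T) - T / 2 = w1 - w2 - T / 2 + (- l)%:~R * T.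
  by rewrite mulrNz; ring.
have -> : w1 - (w2 + l%:~R * T) = w1 - w2 + (- l)%:~R * T by rewrite mulrNz; ring.
have -> : w2 + l%:~R * T + 1 / 2 = w2 + 1 / 2 + l%:~R * T by ring.
rewrite !theta_product_shift [RHS]mulrDr; congr (_ + _).
  have -> : e (- (l%:~R * (l%:~R + 1) / 2 * T)) * e (- (w1 / 2)) *
      e ((l%:~R + 1 / 2) * (w2 + l%:~R * T))
    = e (l%:~R ^+ 2 / 2 * T + l%:~R * w2) * e ((w2 - w1) / 2).
    by rewrite -!eD; congr e; field.
  by rewrite !mulrA.
set s1 := e (- ((- l)%:~R ^+ 2 / 2 * T) - (- l)%:~R * (w1 - w2 - T / 2 + 1 / 2)).
set s2 := e (- ((- l)%:~R ^+ 2 / 2 * T) - (- l)%:~R * (w1 - w2 + 1 / 2)).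
set s3 := e (- (l%:~R ^+ 2 / 2 * T) - l%:~R * (w2 + 1 / 2 + 1 / 2)).
(* The exponents of the two sides differ by the integer [l]. *)
have E : e ((w2 + l%:~R * T - w1) / 2) * s1
    = e (l%:~R ^+ 2 / 2 * T + l%:~R * w2) * e ((w2 - w1) / 2) * (s2 * s3).
  rewrite /s1 /s2 /s3 -!eD -[RHS](eDint _ l); congr e.
  by rewrite mulrNz; field.
have : s2 != 0 by exact: e_neq0.
have : s3 != 0 by exact: e_neq0.
move: s1 s2 s3 (e _) (e (l%:~R ^+ 2 / 2 * T + l%:~R * w2)) (e ((w2 - w1) / 2)) E.
move=> s1 s2 s3 u v w E s30 s20.
move: (_ ^+ 3) (theta_product (w1 - w2 - T / 2)) (theta_product (w1 + 1 / 2)).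
move: (theta_product _) (theta_product _) (theta_product _) (e _) => y1 y2 y3 c x1 x2 x3.
rewrite !invfM; move: y1^-1 y2^-1 y3^-1 => {}y1 {}y2 {}y3.
transitivity (c * (x1 * x2 * x3) * (y1 * y2 * y3) * (u * s1) / (s2 * s3)).
  by field; rewrite s30 s20.
by rewrite E; field; rewrite s30 s20.
Qed.

(** * Evaluation at the lattice points *)

Let pochq a := pochoo (q := e (T / 2) ^+ 2) a.

(** Finite form: multiplying by [poch q q N] gives [poch q q (N + N)], as [(p; q)(-p; q)] collects
    the factors [1 - q^j] with odd [j] and [(q; q)(-q; q)] those with even [j]. Both [poch q q N]
    and [poch q q (N + N)] have the same nonzero limit. *)
Lemma euler_pochoo : pochq (- q) * (pochq p * pochq (- p)) = 1.
Proof.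
have pc a : poch a q @ \oo --> pochq a by exact: (poch_cvg Kc q1).
have c1 : (fun N => poch (- q) q N * (poch p q N * poch (- p) q N)) @ \oo
    --> pochq (- q) * (pochq p * pochq (- p)).
  by apply: cvgM => //; apply: cvgM.
have n0 : pochq q != 0 by exact: euler_product_neq0.
have c2 : (fun N => poch q q (N + N) / poch q q N) @ \oo --> pochq q / pochq q.
  apply: cvgM; last exact: cvgV.
  by apply: (@cvg_oo_comp _ (poch q q) _ (fun N => N + N)%N 0) => [N|]; [lia|exact: pc].
rewrite mulfV // in c2; apply: (cvg_eq_gt0 c1 c2) => N _.
have nz : poch q q N != 0.
  by apply: poch_neq0 => k; rewrite -exprS; apply: (q_not_unity T1 (k := k.+1)).
apply: (mulIf nz); rewrite divfK //; elim: N {nz} => [|N IH].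
  by rewrite /poch !big_ord0 !mulr1.
rewrite addnS addSn !pochS -IH.
have -> : q ^+ (N + N).+1 = q ^+ N * q ^+ N * q by rewrite exprS exprD; ring.
have -> : q ^+ (N + N) = q ^+ N * q ^+ N by rewrite exprD.
move: (poch _ _ _) (poch _ _ _) (poch _ _ _) (poch _ _ _) (q ^+ N) => y1 y2 y3 y4 y5.
by rewrite /q; ring.
Qed.

(** The sum and its reversal under [n -> -n] have equal value; relative to the theta terms at
    [- (T / 2)] their weights are [q^n / (1 + q^n)] and [1 / (1 + q^n)], which add to 1. Hence twice
    the Appell sum is a theta series, summed by the triple product. *)
Lemma lattice0_appell SA : ~ lattice (1 / 2) -> appell_sum (T / 2) (1 / 2) SA ->
  SA = 1 / 2 * (euler_product * theta_pochT (e (T / 2))).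
Proof.
move=> h2 hSA; have hS0 := appell_sum_opp h2 hSA.
rewrite e_half opprK [1 * SA]mul1r in hS0.
have h := jacobi_triple_product Kc p0 T1 (e_neq0 (- (T / 2))).
rewrite -eN opprK in h.
suff -> : euler_product * theta_pochT (e (T / 2)) = SA + SA by field.
apply: (hassum_unique h); apply: (hassum_ext (hassumD hSA hS0)) => n.
have qn : q ^ n != 0 by rewrite expfz_neq0.
have n1 := qe_neq1 n h2; rewrite e_half mulrN1 eq_sym -subr_eq0 opprK in n1.
rewrite (eN (1 / 2)) e_half invrN invr1 -/p -/q !mulrN1 opprK.
have -> : theta_term p (e (T / 2)) n = theta_term p (e (- (T / 2))) n * q ^ n.
  by rewrite !theta_term_e qE -eMz -eD; congr e; field.
by field.
Qed.

Lemma lattice0_closed_form w1 SA : ~ lattice (1 / 2) -> appell_sum (T / 2) (1 / 2) SA ->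
  closed_form w1 0 SA =
  - (1 / 2) * e (T / 8) * e (- (w1 / 2)) * theta_product (w1 - T / 2 + 1 / 2)
  + 1 / 2 * e (T / 4) * e (- (w1 / 2)) *
    (theta_product (T / 2 - 1 / 2) * theta_product (w1 - T / 2) * theta_product (w1 + 1 / 2)
     / theta_product w1).
Proof.
move=> h2 hSA; rewrite /closed_form !add0r subr0.
have n4 := theta_pochT_neq0 hT; have n5 := euler_product_neq0.
set t := e (T / 8); set c := e (1 / 4).
have [t0 c0] : [/\ t != 0 & c != 0] by split; exact: e_neq0.
have c2 : c * c = -1 by rewrite /c -eD -e_half; congr e; field.
have eT : e (T / 2) = t * t * t * t by rewrite /t -!eD; congr e; field.
have thT : theta_product (T / 2) = - (c / t * (euler_product * theta_pochT (e (T / 2)))).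
  rewrite /theta_product theta_pochT_inv eT.
  have -> : e (T / 8 + T / 2 / 2 + 1 / 4) = t * t * t * c.
    by rewrite /t /c -!eD; congr e; field.
  by field.
(* Here the factor [1 - (-1) = 2] is split off from [pochoo (-1)]; it is the origin of the
   coefficient [1 / 2] in the second summand. *)
have th2 : theta_product (1 / 2) = - (t * (euler_product * (2 * (pochq (- q) * pochq (- q))))).
  rewrite /theta_product.
  have -> : e (T / 8 + 1 / 2 / 2 + 1 / 4) = t * (c * c).
    by rewrite /t /c -!eD; congr e; field.
  rewrite c2 eN e_half invrN invr1 /theta_pochT /theta_poch (pochooS Kc q1 (-1)) invrN invr1
    mulN1r -/q [q * -1]mulrN1.
  by rewrite /pochq; ring.
have thm : theta_product (T / 2 - 1 / 2) = (euler_product * (pochq (- p) * pochq (- p))) / t.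
  rewrite /theta_product theta_pochT_inv eB e_half invrN invr1 mulrN1 -/p.
  have -> : e (T / 8 + (T / 2 - 1 / 2) / 2 + 1 / 4) = t * t * t.
    by rewrite /t -!eD; congr e; field.
  have -> : theta_pochT (- p) = pochq (- p) * pochq (- p).
    by rewrite /theta_pochT /theta_poch -/p; congr (_ * pochoo _); rewrite invrN mulrN expr2 mulfK.
  by rewrite /p eT; field.
have PIT : theta_pochT (e (T / 2)) = pochq p * pochq p.
  by rewrite /theta_pochT /theta_poch -/p; congr (_ * pochoo _); rewrite expr2 mulfK.
have eu := euler_pochoo.
have f8 : e (T / 24) ^+ 3 = t by rewrite /t !exprS expr0 mulr1 -!eD; congr e; field.
have f4 : e (T / 4) = t * t by rewrite /t -!eD; congr e; field.
have f2 : e (1 / 2 / 2) = c by rewrite /c; congr e; field.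
have f1 : e (- w1 / 2) = e (- (w1 / 2)) by rewrite mulNr.
rewrite [(e _ * _) ^+ 3]exprMn f8 f4 f2 f1 th2 thm thT (lattice0_appell h2 hSA).
have n1 : pochq (- q) != 0.
  by apply/eqP => h; move: eu; rewrite h mul0r => /eqP; rewrite eq_sym oner_eq0.
have n2 : pochq (- p) != 0.
  by apply/eqP => h; move: eu; rewrite h !mulr0 => /eqP; rewrite eq_sym oner_eq0.
have n3 : pochq p != 0.
  by apply/eqP => h; move: eu; rewrite h mul0r mulr0 => /eqP; rewrite eq_sym oner_eq0.
congr (_ + _).
  move: (e _) (theta_product _) n4 n5 => x1 x2.
  by move: (theta_pochT _) euler_product => x3 Q' n4 n5; field; rewrite t0 c0 n4 n5.
rewrite PIT.
(* Euler's identity trades the products in the denominator for [pochq (- p)], that is, for the theta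
   value at [T / 2 - 1 / 2]. *)
have -> : pochq p = (pochq (- q) * pochq (- p))^-1.
  by apply: (mulfI (mulf_neq0 n1 n2)); rewrite mulfV ?mulf_neq0 // -eu; ring.
move: n1 n2 n5; move: (pochq _) (pochq _) euler_product (theta_product w1).
move: (theta_product _) (theta_product _) (e _) t c t0 c0 {c2 eT thT th2 thm PIT f8 f4 f2}.
move=> x1 x2 E t c t0 c0 m n Q' x3 m0 n0 Q0.
by rewrite !invfM; move: x3^-1 => {}x3; field; rewrite t0 c0 m0 n0 Q0.
Qed.

End AbstractTheta.

(** * Specialization to the complex exponential *)

Section Exponential.
Context {R : realType}.
Local Notation C := (CC R).
Implicit Types (z w : C).

Definition ec w : C := cexp (2 * pi%:C * 'i%C * w).

Lemma epowE z s : epow z s = ec (s%:C * z).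
Proof. by rewrite /epow /ec mulrA. Qed.

Lemma ec_arg w : 2 * pi%:C * 'i%C * w
  = (- (2 * pi * complex.Im w)) +i* (2 * pi * complex.Re w).
Proof.
case: w => a b; rewrite -[2]/(2%:R) -(rmorph_nat (real_complex R)) -rmorphM /=.
by apply/eqP; rewrite eq_complex /=; apply/andP; split; apply/eqP; ring.
Qed.

Lemma cexpD z w : cexp (z + w) = cexp z * cexp w.
Proof.
case: z => a b; case: w => c d; rewrite /cexp /= expRD cosD sinD.
by apply/eqP; rewrite eq_complex /=; apply/andP; split; apply/eqP; ring.
Qed.

Lemma norm_cexp z : `|cexp z| = (expR (complex.Re z))%:C.
Proof.
rewrite /cexp normrM normC_real [X in X%:C * _]ger0_norm ?expR_ge0 //.
by rewrite normc_def /= cos2Dsin2 sqrtr1 mulr1.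
Qed.

Lemma ecD z w : ec (z + w) = ec z * ec w.
Proof. by rewrite /ec mulrDr cexpD. Qed.

Lemma norm_ec w : `|ec w| = (expR (- (2 * pi * complex.Im w)))%:C.
Proof. by rewrite /ec norm_cexp ec_arg. Qed.

Lemma ec_neq0 w : ec w != 0.
Proof.
rewrite -normr_eq0 norm_ec eq_complex /= negb_and gt_eqF //.
exact: expR_gt0.
Qed.

Lemma ec_real (x : R) : ec x%:C = cos (2 * pi * x) +i* sin (2 * pi * x).
Proof. by rewrite /ec ec_arg /cexp /= mulr0 oppr0 expR0 mul1r. Qed.

Lemma ec_half : ec (1 / 2) = -1.
Proof.
have -> : 1 / 2 = (1 / 2 : R)%:C :> C by rewrite rmorphM fmorphV rmorph_nat rmorph1.
rewrite ec_real; have -> : 2 * pi * (1 / 2) = pi :> R by field.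
by rewrite cospi sinpi; apply/eqP; rewrite eq_complex /= oppr0 !eqxx.
Qed.

Lemma ec_quarter : ec (1 / 4) = 'i%C.
Proof.
have -> : 1 / 4 = (1 / 4 : R)%:C :> C by rewrite rmorphM fmorphV rmorph_nat rmorph1.
rewrite ec_real; have -> : 2 * pi * (1 / 4) = pi / 2 :> R by field.
by rewrite cos_pihalf sin_pihalf.
Qed.

Lemma ec_eq1 w : ec w = 1 -> exists m : int, w = m%:~R.
Proof.
move=> h; have im0 : complex.Im w = 0.
  have := norm_ec w; rewrite h normr1 => /(congr1 (@complex.Re R)) /= /esym.
  move/(congr1 (@ln R)); rewrite expRK ln1 => /eqP; rewrite oppr_eq0 mulf_eq0 => /orP[|/eqP//].
  by rewrite mulf_eq0 pnatr_eq0 /= gt_eqF // pi_gt0.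
pose m := Num.floor (complex.Re w); pose r := complex.Re w - m%:~R.
have wE : w = m%:~R + r%:C.
  rewrite -(rmorph_int (real_complex R)) -rmorphD /r addrC subrK.
  by case: (w) im0 => a b /= ->.
have [r0 r1] : 0 <= r /\ r < 1.
  rewrite subr_ge0 ltrBlDr addrC /m; split; first exact: ge_floor.
  by have := lt_succ_floor (complex.Re w); rewrite intrD1.
move: h; rewrite wE ecD (e_int ecD ec_half ec_neq0) mul1r ec_real => /(congr1 (@complex.Re R)) /= hc.
(* The half angle is used because [pi * r] lies in [[0, pi)], where the sine vanishes only at 0. *)
have : sin (pi * r) = 0.
  have : cos (2 * pi * r) = 1 - 2 * sin (pi * r) ^+ 2.
    have -> : 2 * pi * r = pi * r + pi * r by ring.
    have := cos2Dsin2 (pi * r); rewrite cosD; nra.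
  rewrite hc => /eqP; rewrite eq_sym subr_eq addrC -subr_eq subrr eq_sym.
  by rewrite mulf_eq0 pnatr_eq0 /= expf_eq0 /= => /eqP.
move=> s0; exists m; suff -> : r = 0 by rewrite addr0.
apply/eqP; apply: contraT => rn0; have rp : 0 < r by rewrite lt_def rn0.
have : 0 < sin (pi * r).
  by apply: sin_gt0_pi; rewrite mulr_gt0 ?pi_gt0 //= -[ltRHS]mulr1 ltr_pM2l ?pi_gt0.
by rewrite s0 ltxx.
Qed.

End Exponential.

Section Specialization.
Context {R : realType}.
Local Notation C := (CC R).
Implicit Types (z T tau : C).
Let Kc : sumcomplete C := @sumcomplete_complex R.
Let ecD' : forall z w : C, ec (z + w) = ec z * ec w := ecD.
Let half : ec (1 / 2) = -1 :> C := ec_half.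
Let neq0 : forall z : C, ec z != 0 := ec_neq0.
Let eq1 : forall z : C, ec z = 1 -> exists m : int, z = m%:~R := @ec_eq1 R.

Lemma Im_realM (x : R) z : complex.Im (x%:C * z) = x * complex.Im z.
Proof. by case: z => a b /=; rewrite mul0r addr0. Qed.

Lemma ImD z w : complex.Im (z + w) = complex.Im z + complex.Im w.
Proof. by case: z => a b; case: w. Qed.

Lemma ec_half_lt1 T : 0 < complex.Im T -> `|ec (T / 2)| < 1.
Proof.
move=> T0; rewrite norm_ec -(rmorph1 (real_complex R)) ltcR expR_lt1 oppr_lt0.
have -> : T / 2 = (2^-1)%:C * T by rewrite fmorphV rmorph_nat mulrC.
by rewrite Im_realM !mulr_gt0 ?pi_gt0 ?invr_gt0.
Qed.

Lemma thetaE z T : 0 < complex.Im T -> theta z T = theta_product (e := ec) (T := T) z.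
Proof.
move=> T0; rewrite /theta.
apply: hassum_usum.
apply: (hassum_ext (@hassum_theta_product _ Kc _ ecD' half neq0 _ (ec_half_lt1 T0) z)) => n.
rewrite !epowE -ecD'.
have -> : ((n%:~R + 1 / 2) ^+ 2 / 2 : R)%:C = (n%:~R + 1 / 2) ^+ 2 / 2 :> C.
  by rewrite !(rmorphD, rmorphM, rmorphXn, fmorphV, rmorph_int, rmorph1, rmorph_nat).
by have -> : (n%:~R + 1 / 2 : R)%:C = n%:~R + 1 / 2 :> C
  by rewrite !(rmorphD, rmorphM, rmorphXn, fmorphV, rmorph_int, rmorph1, rmorph_nat).
Qed.

Lemma etaE T : 0 < complex.Im T -> Pilot.Defs.eta T = ec (T / 24) * euler_product (e := ec) (T := T).
Proof.
move=> T0; rewrite /Pilot.Defs.eta epowE.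
have -> : (1 / 24 : R)%:C * T = T / 24.
  by rewrite rmorphM fmorphV rmorph1 rmorph_nat mul1r mulrC.
have -> : (fun N : nat => \prod_(1 <= n < N.+1) (1 - epow T n%:R))
    = poch (ec (T / 2) ^+ 2) (ec (T / 2) ^+ 2).
  apply/funext => N; rewrite big_add1 /= big_mkord; apply: eq_bigr => i _.
  have -> : epow T (i.+1)%:R = ec (T / 2) ^+ 2 * (ec (T / 2) ^+ 2) ^+ i.
    by rewrite -exprS epowE rmorph_nat (@qE _ _ ecD') exprnP -(eMz ecD' neq0).
  by [].
by [].
Qed.

Lemma appellAE z1 z2 T SA : appell_sum (e := ec) (T := T) z2 z1 SA ->
  appellA z1 z2 T = ec (z1 / 2) * SA.
Proof.
move=> h; rewrite /appellA epowE.
have -> : (1 / 2 : R)%:C * z1 = z1 / 2.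
  by rewrite rmorphM fmorphV rmorph1 rmorph_nat mul1r mulrC.
suff -> : usum (fun n : int => (-1) ^ n * epow T ((n * (n + 1))%:~R / 2) * epow z2 n%:~R
    / (1 - epow z1 1 * epow T n%:~R)) = SA by [].
apply: hassum_usum; apply: (hassum_ext h) => n.
rewrite (theta_term_e ecD' half neq0) !epowE rmorph1 (mul1r z1) (@qE _ _ ecD') -(eMz ecD' neq0) rmorph_int.
rewrite [ec z1 * _]mulrC.
suff -> : ec (n%:~R * (z2 + 1 / 2) + n%:~R * (n%:~R + 1) / 2 * T)
  = (-1) ^ n * ec (((n * (n + 1))%:~R / 2)%:C * T) * ec (n%:~R * z2) by [].
rewrite -half -(eMz ecD' neq0) -!ecD'.
have -> : ((n * (n + 1))%:~R / 2 : R)%:C = n%:~R * (n%:~R + 1) / 2 :> C.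
  by rewrite !(rmorphD, rmorphM, fmorphV, rmorph_int, rmorph1, rmorph_nat).
have -> : n%:~R * (z2 + 1 / 2) + n%:~R * (n%:~R + 1) / 2 * T
  = n%:~R * (1 / 2) + n%:~R * (n%:~R + 1) / 2 * T + n%:~R * z2 by ring.
by [].
Qed.

Lemma f3_boundaryE tau z1 z2 (l : int) SA : 0 < complex.Im tau ->
  complex.Im z2 = l%:~R * complex.Im tau ->
  appell_sum (e := ec) (T := 3 * tau) (3 * tau / 2) (3 * z2 - l%:~R * (3 * tau) + 1 / 2) SA ->
  f3_boundary z1 z2 tau = boundary_form (e := ec) (T := 3 * tau) (3 * z1) (3 * z2) l SA.
Proof.
move=> v0 y2 hSA.
have T0 : 0 < complex.Im (3 * tau).
  have -> : 3 * tau = 3%:C * tau by rewrite rmorph_nat.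
  by rewrite Im_realM mulr_gt0.
have v1 : complex.Im tau != 0 by rewrite gt_eqF.
rewrite /f3_boundary /mu y2 (mulfK v1); cbv zeta.
rewrite (etaE T0).
rewrite !(thetaE _ T0).
have -> : 3 * z2 - (3 * l%:~R)%:C * tau + 1 / 2 = 3 * z2 - l%:~R * (3 * tau) + 1 / 2.
  by rewrite rmorphM rmorph_nat rmorph_int; ring.
rewrite (appellAE hSA) /boundary_form !epowE.
have -> : (- (3 * l%:~R / 2) * (l%:~R + 1))%:C * tau = - (l%:~R * (l%:~R + 1) / 2 * (3 * tau)).
  by rewrite !(rmorphN, rmorphD, rmorphM, fmorphV, rmorph_int, rmorph1, rmorph_nat); field.
have -> : (- (3 / 2))%:C * z1 = - (3 * z1 / 2).
  by rewrite !(rmorphN, rmorphD, rmorphM, fmorphV, rmorph_int, rmorph1, rmorph_nat); field.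
have -> : (3 * l%:~R + 3 / 2)%:C * z2 = (l%:~R + 1 / 2) * (3 * z2).
  by rewrite !(rmorphN, rmorphD, rmorphM, fmorphV, rmorph_int, rmorph1, rmorph_nat); field.
have -> : (3 / 2)%:C * (z2 - z1) = (3 * z2 - 3 * z1) / 2.
  by rewrite !(rmorphN, rmorphD, rmorphM, fmorphV, rmorph_int, rmorph1, rmorph_nat); field.
have -> : 3 * (z1 - z2) = 3 * z1 - 3 * z2 by ring.
by rewrite ec_quarter.
Qed.

Lemma f3_latticeE tau z1 (l : int) : 0 < complex.Im tau ->
  f3_lattice z1 l tau = ec (l%:~R ^+ 2 / 2 * (3 * tau)) *
   (- (1 / 2) * ec (3 * tau / 8) * ec (- (3 * z1 / 2)) *
      theta_product (e := ec) (T := 3 * tau) (3 * z1 - 3 * tau / 2 + 1 / 2)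
  + 1 / 2 * ec (3 * tau / 4) * ec (- (3 * z1 / 2)) *
    (theta_product (e := ec) (T := 3 * tau) (3 * tau / 2 - 1 / 2)
     * theta_product (e := ec) (T := 3 * tau) (3 * z1 - 3 * tau / 2)
     * theta_product (e := ec) (T := 3 * tau) (3 * z1 + 1 / 2)
     / theta_product (e := ec) (T := 3 * tau) (3 * z1))).
Proof.
move=> v0.
have T0 : 0 < complex.Im (3 * tau).
  have -> : 3 * tau = 3%:C * tau by rewrite rmorph_nat.
  by rewrite Im_realM mulr_gt0.
rewrite /f3_lattice !thetaE // !epowE.
have -> : (3 * l%:~R ^+ 2 / 2 + 3 / 8 : R)%:C * tau = l%:~R ^+ 2 / 2 * (3 * tau) + 3 * tau / 8.
  by rewrite !(rmorphN, rmorphD, rmorphM, rmorphXn, fmorphV, rmorph_int, rmorph1, rmorph_nat); field.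
have -> : (3 * l%:~R ^+ 2 / 2 + 3 / 4 : R)%:C * tau = l%:~R ^+ 2 / 2 * (3 * tau) + 3 * tau / 4.
  by rewrite !(rmorphN, rmorphD, rmorphM, rmorphXn, fmorphV, rmorph_int, rmorph1, rmorph_nat); field.
have -> : (- (3 / 2))%:C * z1 = - (3 * z1 / 2).
  by rewrite !(rmorphN, rmorphD, rmorphM, fmorphV, rmorph_int, rmorph1, rmorph_nat); field.
rewrite !ecD'; move: (theta_product _) (theta_product _) (theta_product _) (theta_product _)^-1.
by move: (theta_product _) (ec _) (ec _) (ec _) (ec _) => *; ring.
Qed.

End Specialization.

(** * The sum over the cone *)

Definition cone_sign (r M : int) : int :=
  if (0 <= r) && (0 <= M) then 1 else if (r < 0) && (M < 0) then -1 else 0.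

Lemma cone_sign_step r M : cone_sign r (M + 1) - cone_sign r M = (M == -1).
Proof. by rewrite /cone_sign; case: (ltP r 0) => hr; case: (ltgtP M (-1)) => hM; do ?case: ifP; lia. Qed.

(** The strict inequalities [0 < d < a < 1] rule out every tie: [M + d] has the sign dictated by
    [M], and [x1 - x2 = r + a - d] the one dictated by [r]. At [d = 0] the terms with [M = 0],
    [r < 0] would contribute -1 instead of 0. *)
Lemma chi3_cone {R : realType} (r M : int) (a d : R) : 0 < a < 1 -> 0 < d < a ->
  chi3 ((r + M)%:~R + a) (M%:~R + d) = (cone_sign r M)%:~R.
Proof.
move=> /andP[a0 a1] /andP[d0 da]; rewrite /chi3 /heaviside /heaviside_star /cone_sign rmorphD /=.
case: (leP 0 r) => hr; case: (leP 0 M) => hM /=.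
- have r0 : 0 <= r%:~R :> R by rewrite ler0z.
  have M0 : 0 <= M%:~R :> R by rewrite ler0z.
  rewrite gtr0_sg; last lra.
  rewrite !ger0_norm; try lra.
  rewrite mulr_ge0; try lra.
  by rewrite (_ : 0 < _) ?mulr1 //; lra.
- have r0 : 0 <= r%:~R :> R by rewrite ler0z.
  have M0 : M%:~R <= -1 :> R by rewrite -[-1]/((-1)%:~R) ler_int; lia.
  have b0 : M%:~R + d < 0 by lra.
  case: (ltgtP 0 (r%:~R + M%:~R + a)) => h.
  + rewrite (_ : (0 <= _) = false) ?mulr0 //; apply/negbTE; rewrite -ltNge; nra.
  + rewrite (ltr0_norm h) (ltr0_norm b0) (_ : (0 < _) = false) ?mulr0 ?mul0r //.
    by apply/negbTE; rewrite -leNgt; lra.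
  by rewrite -h sgr0 !mul0r.
- have r0 : r%:~R <= -1 :> R by rewrite -[-1]/((-1)%:~R) ler_int; lia.
  have M0 : 0 <= M%:~R :> R by rewrite ler0z.
  have b0 : 0 < M%:~R + d by lra.
  case: (ltgtP 0 (r%:~R + M%:~R + a)) => h.
  + rewrite (gtr0_norm h) (gtr0_norm b0) (_ : (0 < _) = false) ?mulr0 ?mul0r //.
    by apply/negbTE; rewrite -leNgt; lra.
  + rewrite (_ : (0 <= _) = false) ?mulr0 //; apply/negbTE; rewrite -ltNge; nra.
  by rewrite -h sgr0 !mul0r.
have r0 : r%:~R <= -1 :> R by rewrite -[-1]/((-1)%:~R) ler_int; lia.
have M0 : M%:~R <= -1 :> R by rewrite -[-1]/((-1)%:~R) ler_int; lia.
rewrite ltr0_sg; last lra.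
rewrite !ltr0_norm; try lra.
rewrite (_ : 0 < _ = true); last lra.
rewrite (_ : 0 <= _ = true) ?mulr1 //.
by nra.
Qed.

Lemma ec_cvg1 {R : realType} {T : Type} (FF : set_system T) {PF : Filter FF} (h : T -> CC R) :
  complex.Re (h t) @[t --> FF] --> (0 : R) -> complex.Im (h t) @[t --> FF] --> (0 : R) ->
  ec (h t) @[t --> FF] --> (1 : CC R).
Proof.
move=> re im.
have real_cvg (f : T -> R) (l : R) : f t @[t --> FF] --> l ->
    ((f t)%:C : CC R) @[t --> FF] --> (l%:C : CC R).
  move=> /cvgrPdist_lt H; apply/cvgrPdist_lt => e /gt0_complexE[-> e0].
  by near=> t; rewrite -rmorphB normC_real ltcR; near: t; exact: H.
have cont (g : R -> R) (u : T -> R) (l : R) : continuous g -> u t @[t --> FF] --> l ->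
    g (u t) @[t --> FF] --> g l.
  by move=> gc ul; exact: (cvg_comp _ _ ul (gc l)).
have mul0 (c : R) (u : T -> R) : u t @[t --> FF] --> 0 -> c * u t @[t --> FF] --> 0.
  by move=> u0; rewrite -[X in _ --> X](mulr0 c); apply: cvgM => //; exact: cvg_cst.
have c1 : (expR (- (2 * pi * complex.Im (h t)))) @[t --> FF] --> (1 : R).
  rewrite -[X in _ --> X]expR0 -[X in expR X]oppr0.
  apply: (cont expR (fun t => - (2 * pi * complex.Im (h t)))); first exact: continuous_expR.
  by apply: cvgN; exact: mul0.
have c2 : (cos (2 * pi * complex.Re (h t))) @[t --> FF] --> (1 : R).
  rewrite -[X in _ --> X]cos0.
  by apply: (cont cos (fun t => 2 * pi * complex.Re (h t))); [exact: continuous_cos|exact: mul0].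
have c3 : (sin (2 * pi * complex.Re (h t))) @[t --> FF] --> (0 : R).
  rewrite -[X in _ --> X]sin0.
  by apply: (cont sin (fun t => 2 * pi * complex.Re (h t))); [exact: continuous_sin|exact: mul0].
have E w : ec w = (expR (- (2 * pi * complex.Im w)))%:C *
    ((cos (2 * pi * complex.Re w))%:C + 'i * (sin (2 * pi * complex.Re w))%:C) :> CC R.
  by rewrite /ec ec_arg /cexp /= [X in _ * X = _]complexE.
under eq_fun do rewrite E.
have -> : (1 : CC R) = 1%:C * (1%:C + 'i * 0%:C) by rewrite mulr0 addr0 mulr1.
apply: cvgM; first exact: real_cvg.
apply: cvgD; first exact: real_cvg.
by apply: cvgM; [exact: cvg_cst|exact: real_cvg].
Unshelve. all: by end_near. Qed.

Lemma ec_split {R : realType} (A z x : CC R) (c y : R) :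
  ec (A + c%:C * (z + x * y%:C)) = ec (A + c%:C * z) * ec ((c * y)%:C * x).
Proof.
rewrite -ecD rmorphM; have -> : A + c%:C * (z + x * y%:C) = A + c%:C * z + c%:C * y%:C * x by ring.
by [].
Qed.

Lemma cvg_mull1 {K : numFieldType} {T : Type} (FF : set_system T) {PF : Filter FF} (A : K)
    (f : T -> K) : f @ FF --> (1 : K) -> (fun t => A * f t) @ FF --> A.
Proof.
move=> f1; have := cvgM (cvg_cst A) f1.
by rewrite mulr1; apply.
Qed.

(** Both halves of the cone expand the same fraction: in powers of [y] for [r >= 0], and, with a
    minus sign, in powers of [y^-1] for [r < 0]. Comparing the sum with its shift treats both at
    once. *)
Lemma cone_row {K : numFieldType} (r : int) (x y : K) (F : int -> K) S :
  (forall M, F M = (cone_sign r M)%:~R * (x * y ^ M)) -> y != 0 -> y != 1 ->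
  hassum F S -> S = x / (1 - y).
Proof.
move=> FE y0 yn1 hS.
have y1n : 1 - y != 0 by rewrite subr_eq0 eq_sym.
have h := hassum_reindex (h := fun M : int => M + 1) (h' := fun M => M - 1)
  (fun M => addrK 1 M) (fun M => subrK 1 M) hS.
have hd := hassumD h (hassumZ (- y) hS).
have hfs : hassum (fun M : int => (M == -1)%:R * x : K) x.
  have := @hassum_fset K int (fun M : int => (M == -1)%:R * x) [fset (-1 : int)]%fset.
  rewrite /psum big_seq_fset1 eqxx mul1r; apply => M.
  by rewrite inE => /negbTE ->; rewrite mul0r.
(* Shifting [M] by one multiplies [F M] by [y], except at [M = -1], where [cone_sign] jumps. *)
have E : S + - y * S = x.
  apply: (hassum_unique (hassum_ext hd _) hfs) => M /=; rewrite !FE.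
  have -> : y ^ (M + 1) = y ^ M * y by rewrite expfzDr.
  have sE : (cone_sign r (M + 1))%:~R = (cone_sign r M)%:~R + (M == -1)%:R :> K.
    by have := cone_sign_step r M => /eqP; rewrite subr_eq => /eqP ->; rewrite rmorphD addrC.
  rewrite sE.
  case: eqP => [-> /=|_]; last by rewrite /=; ring.
  by rewrite exprN1 /=; field.
by rewrite -E; field.
Qed.

(** The integer [r - k] added on the left is invisible to [e]. It accounts for the two halves on the
    right: one is the shift of the elliptic variable, the other encodes the sign [(-1)^(r - k)] in
    [theta_term]. *)
Lemma cone_exponent {K : numFieldType} (tau z1 z2 : K) (r M k l : int) :
  3 / 2 * ((r + M - k)%:~R ^+ 2 - (M - l)%:~R ^+ 2) * tau + 3 * (r + M - k)%:~R * z1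
    + - 3 * (M - l)%:~R * z2 + (r - k)%:~R
  = l%:~R ^+ 2 / 2 * (3 * tau) + l%:~R * (3 * z2 - l%:~R * (3 * tau))
    + ((r - k)%:~R * (3 * z1 - 3 * tau / 2 + 1 / 2 + 1 / 2)
       + (r - k)%:~R * ((r - k)%:~R + 1) / 2 * (3 * tau))
    + M%:~R * ((r - k)%:~R * (3 * tau) + (3 * z1 - (3 * z2 - l%:~R * (3 * tau)))).
Proof. by rewrite !(rmorphD, rmorphN) /=; field. Qed.

(** * Decay, limit and evaluation of the cone sum *)

Section Cone.
Context {R : realType}.
Local Notation C := (CC R).
Let Kc : sumcomplete C := @sumcomplete_complex R.
Context (tau z1 : C) (v0 : 0 < complex.Im tau).
Local Notation v := (complex.Im tau).
Context (k : int) (a : R) (a01 : 0 < a < 1) (y1 : complex.Im z1 = (k%:~R + a) * v).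

(* Here [rM = (r, M)], and [cone_sign] is the value of [chi3] for small positive [eps] (see
   [chi3_cone]); it differs from [chi3] on the boundary [eps = 0]. *)
Definition cone_term (l : int) (z2 : C) (rM : int * int) : C :=
  let n1 : R := (rM.1 + rM.2 - k)%:~R in
  let n2 : R := (rM.2 - l)%:~R in
  (cone_sign rM.1 rM.2)%:~R%:C *
  ec ((3 / 2 * (n1 ^+ 2 - n2 ^+ 2))%:C * tau + (3 * n1)%:C * z1 + (- 3 * n2)%:C * z2).

Lemma f3_cone (l : int) z2 (eps : R) S : complex.Im z2 = l%:~R * v -> 0 < eps -> eps < a * v ->
  hassum (cone_term l (z2 + 'i * eps%:C)) S -> f3 z1 (z2 + 'i * eps%:C) tau = S.
Proof.
move=> y2 e0 ea hS; apply: hassum_usum.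
have hS' := hassum_reindex (h := fun n : int * int => (n.1 - n.2 + k - l, n.2 + l))
  (h' := fun n : int * int => (n.1 + n.2 - k, n.2 - l)) _ _ hS.
apply: (hassum_ext (hS' _ _)).
- by move=> [n1 n2] /=; congr (_, _); ring.
- by move=> [n1 n2] /=; congr (_, _); ring.
move=> [n1 n2] /=; rewrite /cone_term /=.
have -> : n1 - n2 + k - l + (n2 + l) - k = n1 by ring.
have -> : n2 + l - l = n2 by ring.
rewrite !ecD !epowE [LHS]mulrA [X in X * _ = _]mulrA -(@chi3_cone R _ _ a (eps / v) a01); last first.
  by rewrite divr_gt0 //= ltr_pdivrMr.
have vn : v != 0 by rewrite gt_eqF.
have -> : (n1 - n2 + k - l + (n2 + l))%:~R + a = n1%:~R + complex.Im z1 / v.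
  by rewrite y1 mulfK // !(rmorphD, rmorphB) /=; ring.
have -> : (n2 + l)%:~R + eps / v = n2%:~R + complex.Im (z2 + 'i * eps%:C) / v.
  have -> : complex.Im (z2 + 'i * eps%:C) = l%:~R * v + eps by rewrite ImD y2 /= mul0r add0r mul1r.
  by rewrite mulrDl mulfK // rmorphD /=; ring.
by [].
Qed.

(** The distance from [Im z1 / Im tau] to the nearest integer. *)
Definition cone_rate : R := Num.min a (1 - a).

Lemma cone_rate_gt0 : 0 < cone_rate.
Proof. by rewrite lt_min; move: a01 => /andP[? ?]; apply/andP; split; lra. Qed.

(** The right side factors as [(r + a)(r + 2 M + a)]. On the cone both factors have the same sign;
    the first is at least [cone_rate] in absolute value and the second at least [|r| + |M|]. *)
Lemma cone_quadratic (r M : int) : cone_sign r M != 0 ->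
  cone_rate * ((absz r)%:R + (absz M)%:R) <= ((r + M)%:~R + a) ^+ 2 - M%:~R ^+ 2.
Proof.
have [c1 c2] : cone_rate <= a /\ cone_rate <= 1 - a.
  by split; rewrite ge_min lexx ?orbT.
have c0 := cone_rate_gt0; move: a01 => /andP[a0 a1].
rewrite rmorphD /= /cone_sign; case: (leP 0 r) => hr; case: (leP 0 M) => hM //= _.
  have r0 : 0 <= r%:~R :> R by rewrite ler0z.
  have M0 : 0 <= M%:~R :> R by rewrite ler0z.
  have -> : (absz r)%:R = r%:~R :> R by rewrite -[in RHS](gez0_abs hr).
  have -> : (absz M)%:R = M%:~R :> R by rewrite -[in RHS](gez0_abs hM).
  have : 0 <= (r%:~R + a - cone_rate) * (r%:~R + 2 * M%:~R + a) by apply: mulr_ge0; lra.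
  have : 0 <= cone_rate * (M%:~R + a) by apply: mulr_ge0; lra.
  by nra.
have r0 : r%:~R <= -1 :> R by rewrite -[-1]/((-1)%:~R) ler_int; lia.
have M0 : M%:~R <= -1 :> R by rewrite -[-1]/((-1)%:~R) ler_int; lia.
have -> : (absz r)%:R = - r%:~R :> R by rewrite -[in RHS](opprK r) mulrNz opprK -ltz0_abs.
have -> : (absz M)%:R = - M%:~R :> R by rewrite -[in RHS](opprK M) mulrNz opprK -ltz0_abs.
have : 0 <= (- r%:~R - a - cone_rate) * (- r%:~R - 2 * M%:~R - a) by apply: mulr_ge0; lra.
have : 0 <= cone_rate * (- M%:~R - a) by apply: mulr_ge0; lra.
by nra.
Qed.

Definition cone_decay : R := expR (- (3 / 2 * pi * v * cone_rate)).

Lemma cone_decay01 : 0 < cone_decay /\ cone_decay < 1.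
Proof.
split; first exact: expR_gt0.
by rewrite expR_lt1 oppr_lt0 !mulr_gt0 ?pi_gt0 ?divr_gt0 ?cone_rate_gt0.
Qed.

(** Completing the square gives the exponent [3/2 v ((r + M + a)^2 - M^2 - (k + a)^2 + l^2)]. Half
    of the decay provided by [cone_quadratic] is kept in [cone_decay]; the other half absorbs the
    contribution of [w], which fixes the bound [v * cone_rate / 4]. The constants in [k] and [l] go
    into [D]. *)
Lemma cone_term_bound (l : int) z2 : complex.Im z2 = l%:~R * v -> exists2 B : R, 0 <= B &
  forall (w : C) rM, `|complex.Im w| <= v * cone_rate / 4 ->
    `|cone_term l (z2 + w) rM| <= B%:C * (cone_decay%:C ^+ absz rM.1 * cone_decay%:C ^+ absz rM.2).
Proof.
move=> y2; pose D := 3 / 2 * v * (k%:~R + a) ^+ 2 + 3 / 4 * v * cone_rate * (absz l)%:R.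
exists (expR (2 * pi * D)); first exact: expR_ge0.
move=> w [r M] hw; rewrite /cone_term normrM norm_ec.
have r1 : 0 <= cone_decay by exact: expR_ge0.
have [s0|s0] := eqVneq (cone_sign r M) 0.
  rewrite s0 normr0 mul0r -!rmorphXn -!rmorphM ler0c.
  by rewrite !mulr_ge0 ?exprn_ge0 ?expR_ge0.
rewrite normC_real (_ : `|(cone_sign r M)%:~R| = 1 :> R) ?mul1r; last first.
  by move: s0; rewrite /cone_sign; do ?case: ifP => _ //; rewrite ?normr1 ?normrN1.
set A := (absz r)%:R : R; set B := (absz M)%:R : R.
have -> : (expR (2 * pi * D))%:C * (cone_decay%:C ^+ absz r * cone_decay%:C ^+ absz M)
    = (expR (2 * pi * D + (- (3 / 2 * pi * v * cone_rate) * A - (3 / 2 * pi * v * cone_rate) * B)))%:C.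
  rewrite -!rmorphXn -!rmorphM /cone_decay -!expRM_natr -!expRD -/A -/B.
  by have -> : - (3 / 2 * pi * v * cone_rate) * B = - (3 / 2 * pi * v * cone_rate * B) by rewrite mulNr.
rewrite lecR ler_expR.
have hq : cone_rate * (A + B) <= ((r + M)%:~R + a) ^+ 2 - M%:~R ^+ 2 := cone_quadratic s0.
rewrite !ImD !Im_realM ImD y1 y2.
have hl : `|(M - l)%:~R : R| <= B + (absz l)%:R.
  rewrite -[B]/((absz M)%:R) !natr_absz -!intr_norm -rmorphD /= ler_int; exact: ler_normB.
have hMw : `|(M - l)%:~R * complex.Im w| <= (B + (absz l)%:R) * (v * cone_rate / 4).
  by rewrite normrM; apply: ler_pM.
have hMw2 : (M - l)%:~R * complex.Im w <= (B + (absz l)%:R) * (v * cone_rate / 4).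
  exact: le_trans (ler_norm _) hMw.
suff h : - (3 / 2 * ((r + M - k)%:~R ^+ 2 - (M - l)%:~R ^+ 2) * v + 3 * (r + M - k)%:~R * ((k%:~R + a) * v) +
    - 3 * (M - l)%:~R * (l%:~R * v + complex.Im w)) <= D - 3 / 4 * v * cone_rate * A - 3 / 4 * v * cone_rate * B.
  have := ler_wpM2l (_ : 0 <= 2 * pi) h; rewrite mulr_ge0 ?pi_ge0 // => /(_ isT).
  rewrite mulrN; move=> /le_trans; apply; rewrite le_eqVlt; apply/orP; left; apply/eqP.
  by field.
have E : 3 / 2 * ((r + M - k)%:~R ^+ 2 - (M - l)%:~R ^+ 2) * v + 3 * (r + M - k)%:~R * ((k%:~R + a) * v) +
    - 3 * (M - l)%:~R * (l%:~R * v) = 3 / 2 * v * ((((r + M)%:~R + a) ^+ 2 - M%:~R ^+ 2)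
      - (k%:~R + a) ^+ 2 + l%:~R ^+ 2).
  by rewrite !(rmorphD, rmorphB) /=; field.
have hv : 3 / 2 * v * (cone_rate * (A + B)) <= 3 / 2 * v * (((r + M)%:~R + a) ^+ 2 - M%:~R ^+ 2).
  by apply: ler_wpM2l => //; rewrite mulr_ge0 ?divr_ge0 // ltW.
have hl2 : 0 <= 3 / 2 * v * l%:~R ^+ 2 by apply: mulr_ge0; rewrite ?sqr_ge0 // mulr_ge0 ?divr_ge0 // ltW.
have hA : 0 <= v * cone_rate * A by do ![apply: mulr_ge0] => //; apply: ltW => //; exact: cone_rate_gt0.
rewrite /D; nra.
Qed.

Lemma cone_term_bounded_psum (B : R) : 0 <= B -> bounded_psum (fun rM : int * int =>
  B%:C * (cone_decay%:C ^+ absz rM.1 * cone_decay%:C ^+ absz rM.2) : C).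
Proof.
have [d0 d1] := cone_decay01.
have d0' : (0 : C) <= cone_decay%:C by rewrite ler0c ltW.
have d1' : (cone_decay%:C : C) < 1 by rewrite -(rmorph1 (real_complex R)) ltcR.
move=> B0; apply: bounded_psumZ; first by rewrite ler0c.
have pos (n : int) : (0 : C) <= cone_decay%:C ^+ absz n by rewrite exprn_ge0.
exact: (bounded_psum_prod pos pos (bounded_psum_geoZ d0' d1') (bounded_psum_geoZ d0' d1')).
Qed.

Lemma hassum_cone_exists (l : int) z2 (w : C) : complex.Im z2 = l%:~R * v ->
  `|complex.Im w| <= v * cone_rate / 4 -> exists S, hassum (cone_term l (z2 + w)) S.
Proof.
move=> y2 hw; have [B B0 HB] := cone_term_bound y2.
apply: (Kc (cone_term_bounded_psum B0)) => rM; exact: HB.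
Qed.

(** The direction [x] is left free: ['i] gives the limit defining the boundary value, and 1 gives
    the continuity along real shifts used at the cancelling poles. *)
Lemma cone_cvg {T : Type} (FF : set_system T) {PF : Filter FF} (l : int) z2 (u : T -> R) (x : C)
    (S : T -> C) S0 :
  complex.Im z2 = l%:~R * v -> u @ FF --> 0 ->
  (\forall t \near FF, hassum (cone_term l (z2 + x * (u t)%:C)) (S t)) ->
  hassum (cone_term l z2) S0 -> S @ FF --> S0.
Proof.
move=> y2 u0 hS hS0; have [B B0 HB] := cone_term_bound y2.
have rate0 : 0 < v * cone_rate / 4 by rewrite !mulr_gt0 ?cone_rate_gt0.
have ux (c : R) : c * u t @[t --> FF] --> 0.
  by rewrite -[X in _ --> X](mulr0 c); apply: cvgM => //; exact: cvg_cst.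
have Imx t : complex.Im (x * (u t)%:C) = complex.Im x * u t.
  by rewrite mulrC Im_realM mulrC.
apply: (hassum_dominated Kc (cone_term_bounded_psum B0) _ _ _ hS hS0).
- move=> rM; have := HB 0 rM; rewrite addr0; apply.
  by rewrite normr0 ltW.
- have /cvgrPdist_le/(_ _ rate0) := ux (complex.Im x).
  apply: filterS => t h rM; apply: HB; rewrite Imx.
  by move: h; rewrite sub0r normrN.
move=> [r M]; rewrite /cone_term /=.
set A := (_ %:C * tau + _); set c := (- 3 * (M - l)%:~R : R).
have E t : ec (A + c%:C * (z2 + x * (u t)%:C)) = ec (A + c%:C * z2) * ec ((c * u t)%:C * x).
  exact: ec_split.
under eq_fun do rewrite E mulrA.
suff H : ec ((c * u t)%:C * x) @[t --> FF] --> (1 : C).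
  exact: cvg_mull1 H.
apply: ec_cvg1.
  have -> : (fun t => complex.Re ((c * u t)%:C * x)) = (fun t => (c * complex.Re x) * u t).
    by apply/funext => t; case: (x) => x1 x2 /=; ring.
  exact: ux.
have -> : (fun t => complex.Im ((c * u t)%:C * x)) = (fun t => (c * complex.Im x) * u t).
  by apply/funext => t; rewrite Im_realM; ring.
exact: ux.
Qed.

Let ecD' : forall z w : C, ec (z + w) = ec z * ec w := ecD.
Let half : ec (1 / 2) = -1 :> C := ec_half.
Let neq0 : forall z : C, ec z != 0 := ec_neq0.
Let eq1 : forall z : C, ec z = 1 -> exists m : int, z = m%:~R := @ec_eq1 R.
Let T : C := 3 * tau.

Lemma ImT : complex.Im T = 3 * v.
Proof. by rewrite /T -(rmorph_nat (real_complex R)) Im_realM. Qed.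

Lemma not_lattice_Im (z : C) (c : R) : complex.Im z = c * (3 * v) ->
  (forall m : int, c != m%:~R) -> ~ in_lattice z T.
Proof.
move=> zc hc [m [n E]]; have /eqP := hc m; apply.
have v3 : 3 * v != 0 by rewrite mulf_neq0 // gt_eqF.
apply: (mulIf v3); rewrite -zc E ImD -(rmorph_int (real_complex R)) Im_realM ImT.
by rewrite -(rmorph_int (real_complex R)) /= addr0.
Qed.

Lemma not_int (m n : int) : m%:~R + a != n%:~R :> R.
Proof.
move: a01 => /andP[a0 a1]; apply/eqP => h.
have : a = (n - m)%:~R by rewrite rmorphB /= -h; ring.
move=> am; move: a0 a1; rewrite am ltr0z -[1]/(1%:~R) ltr_int; lia.
Qed.

Lemma period_half_not_lattice : ~ in_lattice (T / 2) T.
Proof.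
clear a01 y1; apply: (@not_lattice_Im _ (1 / 2)).
    have -> : T / 2 = (1 / 2 : R)%:C * T by rewrite rmorphM fmorphV rmorph1 rmorph_nat mul1r mulrC.
    by rewrite Im_realM ImT.
  move=> m; apply/eqP => h.
  have : (1 : R) = (m + m)%:~R by rewrite rmorphD /= -h; field.
  by move/eqP; rewrite -[X in X == _]/(1%:~R) eqr_int; lia.
Qed.

(** This isolates the poles along the real direction: a real shift between two lattice points has no
    component along [T], hence is an integer. *)
Lemma lattice_eq0 (z : C) (x : R) : in_lattice z T -> in_lattice (z + x%:C) T ->
  exists n : int, x = n%:~R.
Proof.
move=> [m [n E]] [m' [n' E']]; exists (n' - n).
have h : x%:C = (m' - m)%:~R * T + (n' - n)%:~R.
  by rewrite !rmorphB /= mulrBl addrACA -opprD -E' -E [z + _]addrC addrK.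
have im : 0 = (m' - m)%:~R * (3 * v) :> R.
  have := congr1 (@complex.Im R) h.
  by rewrite ImD -!(rmorph_int (real_complex R)) Im_realM ImT /= addr0.
have m0 : (m' - m)%:~R = 0 :> R.
  apply/eqP; move/esym/eqP: im; rewrite mulf_eq0 => /orP[//|].
  by rewrite mulf_eq0 pnatr_eq0 /= gt_eqF.
move: h; rewrite -!(rmorph_int (real_complex R)) m0 mul0r add0r.
by move/(congr1 (@complex.Re R)).
Qed.

Lemma half_not_lattice (l m : int) : ~ in_lattice (l%:~R * T + m%:~R + 1 / 2) T.
Proof.
clear a01 y1; move=> h; have h0 : in_lattice (l%:~R * T + m%:~R) T by exists l, m.
have [|n hn] := @lattice_eq0 _ (1 / 2) h0.
  by rewrite rmorphM fmorphV rmorph1 rmorph_nat.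
have : (1 : R) = (n + n)%:~R by rewrite rmorphD /= -hn; field.
by move/eqP; rewrite -[X in X == _]/(1%:~R) eqr_int; lia.
Qed.

Lemma cone_sum_boundary (l : int) z2 S : complex.Im z2 = l%:~R * v ->
  ~ in_lattice (3 * z2 + 1 / 2) T -> hassum (cone_term l z2) S -> S = f3_boundary z1 z2 tau.
Proof.
move=> y2 hz2 hS; pose w1 : C := 3 * z1; pose w2 : C := 3 * z2 - l%:~R * T.
have T0 : 0 < complex.Im T by rewrite ImT mulr_gt0.
have T1 := ec_half_lt1 T0.
have Iw1 : complex.Im w1 = (k%:~R + a) * (3 * v).
  by rewrite /w1 -(rmorph_nat (real_complex R)) Im_realM y1; ring.
have ImN (z : C) : complex.Im (- z) = - complex.Im z by case: z.
have Iw2 : complex.Im w2 = 0.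
  rewrite /w2 ImD ImN -(rmorph_int (real_complex R)) Im_realM ImT.
  by rewrite -(rmorph_nat (real_complex R)) Im_realM y2; ring.
have Ihalf : complex.Im (1 / 2 : C) = 0.
  by rewrite -(rmorph1 (real_complex R)) -(rmorph_nat (real_complex R)) -fmorphV -rmorphM.
(* The imaginary parts of [w1 - w2] and [w1 + 1 / 2] are [(k + a) Im T], and [k + a] is not an
   integer. *)
have l12 : ~ in_lattice (w1 - w2) T.
  apply: (@not_lattice_Im _ (k%:~R + a)); last exact: not_int.
  by rewrite ImD ImN Iw1 Iw2 subr0.
have l1 : ~ in_lattice (w1 + 1 / 2) T.
  apply: (@not_lattice_Im _ (k%:~R + a)); last exact: not_int.
  by rewrite ImD Iw1 Ihalf addr0.
have lT := period_half_not_lattice.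
have l2 : ~ in_lattice (w2 + 1 / 2) T.
  move=> [m [n E]]; apply: hz2; exists (m + l), n.
  have -> : 3 * z2 + 1 / 2 = w2 + 1 / 2 + l%:~R * T by rewrite /w2; ring.
  by rewrite E rmorphD /=; ring.
have [SA hSA] := appell_sum_exists Kc ecD' neq0 eq1 T1 (T / 2) l2.
pose c0 := l%:~R ^+ 2 / 2 * T + l%:~R * w2.
(* For fixed [r], the terms are geometric in [M], with ratio [X r] and value [x r] at [M = 0], apart
   from the sign. *)
pose X (r : int) : C := ec ((r - k)%:~R * T + (w1 - w2)).
pose x (r : int) : C := ec c0 * theta_term (ec (T / 2)) (ec (w1 - T / 2 + 1 / 2)) (r - k).
have FE r M : cone_term l z2 (r, M) = (cone_sign r M)%:~R * (x r * X r ^ M).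
  rewrite /cone_term /= rmorph_int; congr (_ * _).
  rewrite /x /X (theta_term_e ecD' half neq0) -(eMz ecD' neq0) -!ecD'.
  rewrite -[LHS](eDint ecD' half neq0 _ (r - k)).
  have -> : (3 / 2 * ((r + M - k)%:~R ^+ 2 - (M - l)%:~R ^+ 2) : R)%:C
    = 3 / 2 * ((r + M - k)%:~R ^+ 2 - (M - l)%:~R ^+ 2) :> C.
    by rewrite !(rmorphD, rmorphN, rmorphM, rmorphXn, fmorphV, rmorph_int, rmorph1, rmorph_nat).
  have -> : (3 * (r + M - k)%:~R : R)%:C = 3 * (r + M - k)%:~R :> C.
    by rewrite rmorphM rmorph_nat rmorph_int.
  have -> : (- 3 * (M - l)%:~R : R)%:C = - 3 * (M - l)%:~R :> C.
    by rewrite rmorphM rmorphN rmorph_nat rmorph_int.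
  by rewrite cone_exponent.
have Xn1 r : X r != 1.
  apply/eqP => /eq1[m hm]; apply: l12; exists (- (r - k)), m.
  by rewrite -hm mulrNz; ring.
have hrow r : hassum (fun M => cone_term l z2 (r, M)) (x r / (1 - X r)).
  have [B B0 HB] := cone_term_bound y2.
  have [||Sr hr] := Kc (F := fun M => cone_term l z2 (r, M)) (g := fun M =>
     B%:C * (cone_decay%:C ^+ absz r * cone_decay%:C ^+ absz M)).
  - have [d0 d1] := cone_decay01.
    have d0' : (0 : C) <= cone_decay%:C by rewrite ler0c ltW.
    apply: bounded_psumZ; first by rewrite ler0c.
    apply: bounded_psumZ; first exact: exprn_ge0.
    by apply: bounded_psum_geoZ => //; rewrite -(rmorph1 (real_complex R)) ltcR.
  - move=> M; have := HB 0 (r, M); rewrite addr0; apply.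
    by rewrite normr0 !mulr_ge0 // ltW // cone_rate_gt0.
  by have <- := cone_row (FE r) (neq0 _) (Xn1 r) hr.
have hrows : hassum (fun r => x r / (1 - X r)) S.
  have [B B0 HB] := cone_term_bound y2.
  apply: (hassum_fubini Kc (cone_term_bounded_psum B0) _ hrow hS) => rM.
  have := HB 0 rM; rewrite addr0; apply.
  by rewrite normr0 !mulr_ge0 // ltW // cone_rate_gt0.
have happ : appell_sum (e := ec) (T := T) (w1 - T / 2 + 1 / 2) (w1 - w2) ((ec c0)^-1 * S).
  have h := hassum_reindex (h := fun s : int => s + k) (h' := fun s => s - k)
    (fun s => addrK k s) (fun s => subrK k s) hrows.
  apply: (hassum_ext (hassumZ (ec c0)^-1 h)) => s /=.
  rewrite /x /X addrK mulrA mulrA mulVf // [1 * theta_term _ _ _]mul1r.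
  rewrite (@qE _ _ ecD') -(eMz ecD' neq0) -ecD'.
  by [].
have := closed_formE Kc ecD' half neq0 eq1 T1 lT l12 l2 l1 happ hSA.
move/(congr1 (fun y => ec c0 * y)); rewrite mulVKf // => ->.
rewrite -(boundary_formE Kc ecD' half neq0 T1) (f3_boundaryE z1 v0 y2 hSA).
have -> : w2 + l%:~R * T = 3 * z2 by rewrite /w2 subrK.
by [].
Qed.

Lemma cone_term_shift_int (l m : int) (z2 : C) rM :
  cone_term l (z2 + m%:~R) rM = cone_term l z2 rM.
Proof.
case: rM => r M; rewrite /cone_term /=.
set A := _%:C * tau + _; set c := (- 3 * _)%:C.
have -> : A + c * (z2 + m%:~R) = A + c * z2 + (- 3 * (M - l) * m)%:~R.
  by rewrite mulrDr addrA /c !(rmorphM, rmorphN) /= rmorph_int rmorph_nat.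
by rewrite (eDint ecD' half neq0).
Qed.

End Cone.

Theorem proposition6p4 (R : realType) (tau z1 : CC R) (htau : 0 < complex.Im tau)
    (hz1 : ~ exists k : int, complex.Im z1 = k%:~R * complex.Im tau) :
  (forall z2 : CC R, (exists k : int, complex.Im z2 = k%:~R * complex.Im tau) ->
     (~ in_lattice (3 * z2 + 1 / 2) (3 * tau) ->
        f3 z1 (z2 + 'i%C * eps%:C) tau @[eps --> 0^'+] --> f3_boundary z1 z2 tau)
     /\
     (in_lattice (3 * z2 + 1 / 2) (3 * tau) ->
        exists L : CC R,
          f3_boundary z1 (z2 + t%:C) tau @[t --> (0 : R)^'] --> L
          /\ f3 z1 (z2 + 'i%C * eps%:C) tau @[eps --> 0^'+] --> L))
  /\
  (forall l m : int,
     f3 z1 (l%:~R * tau + m%:~R + 'i%C * eps%:C) tau @[eps --> 0^'+]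
       --> f3_lattice z1 l tau).
Proof.
have vn : complex.Im tau != 0 by rewrite gt_eqF.
pose k := Num.floor (complex.Im z1 / complex.Im tau).
pose a := complex.Im z1 / complex.Im tau - k%:~R.
have y1 : complex.Im z1 = (k%:~R + a) * complex.Im tau.
  by rewrite /a addrC subrK divfK.
have a01 : 0 < a < 1.
  have a0 : a != 0.
    by apply: contra_notN hz1 => /eqP a0; exists k; rewrite y1 a0 addr0.
  rewrite lt_def a0 subr_ge0 ltrBlDr addrC /=.
  rewrite ge_floor /=; have := lt_succ_floor (complex.Im z1 / complex.Im tau).
  by rewrite intrD1.
have a0 : 0 < a by case/andP: a01.
have sums l z2 : complex.Im z2 = l%:~R * complex.Im tau ->
    exists2 S0, hassum (cone_term tau z1 k l z2) S0 &
      f3 z1 (z2 + 'i%C * eps%:C) tau @[eps --> 0^'+] --> S0.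
  move=> y2.
  have [|S0] := hassum_cone_exists htau a01 y1 (w := 0) y2.
    by rewrite normr0 !mulr_ge0 // ltW // cone_rate_gt0.
  rewrite addr0 => hS0; exists S0 => //.
  apply: (cone_cvg htau a01 y1 y2 (u := id) (x := 'i%C) (FF := 0^'+) _ _ hS0).
    exact: cvg_within.
  (* Below the first bound [chi3] agrees with [cone_sign]; below the second the shift stays within
     the range of the uniform majorant. *)
  have e0 : 0 < Num.min (a * complex.Im tau) (complex.Im tau * cone_rate a / 4).
    by rewrite lt_min !mulr_gt0 ?cone_rate_gt0.
  near=> eps.
  have ep : 0 < eps by [].
  have : eps < Num.min (a * complex.Im tau) (complex.Im tau * cone_rate a / 4).
    by near: eps; exact: nbhs_right_lt.
  rewrite lt_min => /andP[e1 e2].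
  have [|S hS] := hassum_cone_exists htau a01 y1 (w := 'i%C * eps%:C) y2.
    by rewrite /= mul0r add0r mul1r gtr0_norm // ltW.
  by rewrite (f3_cone htau a01 y1 y2 ep e1 hS).
have closed l z2 S0 : complex.Im z2 = l%:~R * complex.Im tau ->
    ~ in_lattice (3 * z2 + 1 / 2) (3 * tau) ->
    hassum (cone_term tau z1 k l z2) S0 -> S0 = f3_boundary z1 z2 tau.
  by move=> y2 hz2 hS; exact: (cone_sum_boundary htau a01 y1 y2 hz2 hS).
split.
  move=> z2 [l y2]; have [S0 hS0 cS0] := sums l z2 y2; split.
    by move=> hz2; rewrite -(closed l z2 S0 y2 hz2 hS0).
  move=> hz2; exists S0; split => //.
  apply: (cone_cvg htau a01 y1 y2 (u := id) (x := 1) (FF := 0^') _ _ hS0).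
    exact: cvg_within.
  near=> t.
  have t0 : t != 0 by near: t; exact: nbhs_dnbhs_neq.
  (* Then [3 t] is nonzero of modulus below 1, hence not an integer, and the shifted point leaves
     the lattice, so the closed form holds there. *)
  have t3 : `|t| < 1 / 3.
    near: t; apply: dnbhs0_lt; by rewrite divr_gt0.
  have yt : complex.Im (z2 + 1 * t%:C) = l%:~R * complex.Im tau.
    by rewrite mul1r ImD /= addr0.
  have [|S hS] := hassum_cone_exists htau a01 y1 (w := 1 * t%:C) y2.
    by rewrite mul1r /= normr0 !mulr_ge0 // ltW // cone_rate_gt0.
  have nl : ~ in_lattice (3 * (z2 + 1 * t%:C) + 1 / 2) (3 * tau).
    have -> : 3 * (z2 + 1 * t%:C) + 1 / 2 = 3 * z2 + 1 / 2 + (3 * t)%:C.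
      by rewrite rmorphM rmorph_nat; ring.
    move=> /(lattice_eq0 htau hz2)[n hn].
    have : `|n%:~R| < 1 :> R.
      by rewrite -hn normrM ger0_norm // -ltr_pdivlMl // mulrC.
    rewrite -intr_norm -[1]/(1%:~R) ltr_int => n1.
    have n0 : n = 0 by lia.
    by move: hn; rewrite n0 => /eqP; rewrite mulf_eq0 pnatr_eq0 /= (negbTE t0).
  by move: (hS); rewrite (closed l _ _ yt nl hS) mul1r.
move=> l m.
have T0 : 0 < complex.Im (3 * tau) by rewrite ImT mulr_gt0.
have Im_lt : complex.Im (l%:~R * tau) = l%:~R * complex.Im tau.
  by rewrite -(rmorph_int (real_complex R)) Im_realM.
have Im_ltm : complex.Im (l%:~R * tau + m%:~R) = l%:~R * complex.Im tau.
  by rewrite ImD Im_lt -(rmorph_int (real_complex R)) /= addr0.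
have [S0 hS0 cS0] := sums l (l%:~R * tau + m%:~R) Im_ltm.
suff <- : S0 = f3_lattice z1 l tau by [].
have hS1 : hassum (cone_term tau z1 k l (l%:~R * tau)) S0.
  by apply: (hassum_ext hS0) => rM; exact: cone_term_shift_int.
have half0 : ~ in_lattice (1 / 2) (3 * tau).
  by have := @half_not_lattice _ tau htau 0 0; rewrite mul0r !add0r.
(* At lattice points the argument is half an integer away from the lattice, so the closed form
   applies directly, without a limit in [z2]. *)
have nl : ~ in_lattice (3 * (l%:~R * tau) + 1 / 2) (3 * tau).
  have := @half_not_lattice _ tau htau l 0.
  by have -> : l%:~R * (3 * tau) + 0%:~R + 1 / 2 = 3 * (l%:~R * tau) + 1 / 2 by ring.
rewrite (closed l _ _ Im_lt nl hS1).
have T1 := ec_half_lt1 T0.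
have [SA hSA] := appell_sum_exists (@sumcomplete_complex R) ecD ec_neq0 (@ec_eq1 R) T1
  (3 * tau / 2) half0.
rewrite (@f3_boundaryE _ _ z1 _ l SA htau Im_lt); last first.
  by have -> : 3 * (l%:~R * tau) - l%:~R * (3 * tau) + 1 / 2 = 1 / 2 by ring.
have -> : 3 * (l%:~R * tau) = 0 + l%:~R * (3 * tau) by ring.
rewrite (boundary_formE (@sumcomplete_complex R) ecD ec_half ec_neq0 T1).
rewrite (lattice0_closed_form (@sumcomplete_complex R) ecD ec_half ec_neq0 (@ec_eq1 R) T1
  (period_half_not_lattice htau) _ half0 hSA).
by rewrite f3_latticeE // mulr0 addr0.
Unshelve. all: by end_near. Qed.
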